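(* Let $0<p\le q<\infty$, and let $u:\mathbb{R}_+\to\mathbb{R}_+$ and $w:\mathbb{R}^2_+\to\mathbb{R}_+$ be two weight functions. The following conditions are equivalent: 1. $\Lambda^p(\mathbb{R}^2,u)\subset\Lambda_2^q(w)$. 2. $\displaystyle C=\sup_{D\in\Delta_d}\frac{\left(\int_Dw(s,t)\,ds\,dt\right)^{1/q}}{\left(\int_0^{|D|}u(\theta)\,d\theta\right)^{1/p}}<\infty$. Moreover, $C$ is the best constant for the embedding in 1.
   Context: As domains, $\mathbb{R}_+=(0,\infty)$ and $\mathbb{R}^2_+=(0,\infty)^2$. A weight is a non-negative locally integrable function. For a measurable $f$ on $\mathbb{R}^n$, $f^*(t)=\inf\{\sigma:|\{x:|f(x)|>\sigma\}|\le t\}$, $t>0$. For measurable $f:\mathbb{R}^2\to\mathbb{R}$, written $f(x,y)$, $f_y^*(x,t)$ is the decreasing rearrangement of $f(x,\cdot)$ evaluated at $t$ (with $x$ fixed), a subscript $x$ on a star denotes the decreasing rearrangement with respect to the first variable, and $f^*_{yx}(s,t)=(f_y^*(\cdot,t))^*_x(s)$. $\Lambda^p(\mathbb{R}^2,u)$ is the set of measurable $f:\mathbb{R}^2\to\mathbb{R}$ with $\|f\|_{\Lambda^p(\mathbb{R}^2,u)}=\left(\int_0^\infty(f^*(t))^pu(t)\,dt\right)^{1/p}<\infty$. $\Lambda_2^q(w)$ is the set of measurable $f:\mathbb{R}^2\to\mathbb{R}$ with $\|f\|_{\Lambda_2^q(w)}=\left(\int_{\mathbb{R}^2_+}(f^*_{yx}(s,t))^qw(s,t)\,ds\,dt\right)^{1/q}<\infty$.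 $\Delta_d$ is the family of decreasing sets: $D\subset\mathbb{R}^2_+$ belongs to $\Delta_d$ if $\chi_D$ is decreasing (non-increasing) in each variable; $|D|$ is the Lebesgue measure of $D$. The inclusion in 1 is an embedding: there is a finite constant $c$ with $\|f\|_{\Lambda_2^q(w)}\le c\,\|f\|_{\Lambda^p(\mathbb{R}^2,u)}$ for all measurable $f$; the best constant is the least such $c$. *)

(* Defs.v *)
From HB Require Import structures.
From mathcomp Require Import all_boot all_order all_algebra.
From mathcomp Require Import all_classical all_reals all_analysis.

Set Implicit Arguments.
Unset Strict Implicit.
Unset Printing Implicit Defensive.

Import Order.TTheory GRing.Theory Num.Theory.
Import numFieldNormedType.Exports.

Local Open Scope classical_set_scope.
Local Open Scope ring_scope.
Local Open Scope ereal_scope.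

(* Measurability is Lebesgue (not Borel) measurability: decreasing sets of    *)
(* the plane need not be Borel.  [line R] and [plane R] are R and R * R with  *)
(* the Lebesgue sigma-algebra, on which the completed measures live.          *)
Notation line R := (caratheodory_type ((wlength (@idfun R))^*)%mu).
Notation plane R :=
  (caratheodory_type ((@lebesgue_measure R \x @lebesgue_measure R)^*)%mu).

Section LorentzSpaces.
Context {R : realType}.

Definition mu1 : {measure set (line R) -> \bar R} := completed_lebesgue_measure.

Definition mu2 : {measure set (plane R) -> \bar R} :=
  @completed_measure_extension _ _ _ (@lebesgue_measure R \x @lebesgue_measure R).

Definition halfline : set R := [set t | (0 < t)%R].

Definition quadrant : set (R * R) := [set z | (0 < z.1)%R /\ (0 < z.2)%R].

(* A weight on the half-line is a function of a real variable of which only   *)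
(* the values on [halfline] matter; local integrability is integrability over *)
(* the compact subsets of the open half-line, so u may have infinite integral *)
(* near 0.  The same remarks apply to weights on the quadrant.                *)
Definition weight1 (u : R -> R) : Prop :=
  [/\ forall t, halfline t -> (0 <= u t)%R,
      measurable_fun (halfline : set (line R)) u
    & forall K : set R, compact K -> K `<=` halfline ->
        \int[mu1]_(t in K) (u t)%:E < +oo].

Definition weight2 (w : R * R -> R) : Prop :=
  [/\ forall z, quadrant z -> (0 <= w z)%R,
      measurable_fun (quadrant : set (plane R)) w
    & forall K : set (R * R), compact K -> K `<=` quadrant ->
        \int[mu2]_(z in K) (w z)%:E < +oo].

(* The rearrangement is extended-real valued: it is +oo where the infimum     *)
(* ranges over the empty set.  Functions to be rearranged are extended-real   *)
(* valued as well, so that the construction can be iterated.                  *)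
Definition rearrangement (T : Type) (mu : set T -> \bar R) (f : T -> \bar R)
    (t : R) : \bar R :=
  ereal_inf [set sigma%:E | sigma in
    [set sigma : R | mu [set x | sigma%:E < `|f x|] <= t%:E]].

Definition rearrangement_yx (f : R * R -> R) (s t : R) : \bar R :=
  rearrangement mu1
    (fun x : R => rearrangement mu1 (fun y : R => (f (x, y))%:E) t) s.

Definition Lambda_norm (p : R) (u : R -> R) (f : R * R -> R) : \bar R :=
  (\int[mu1]_(t in halfline)
     (rearrangement mu2 (EFin \o f) t `^ p * (u t)%:E)) `^ (p^-1).

Definition Lambda (p : R) (u : R -> R) : set (R * R -> R) :=
  [set f | measurable_fun (setT : set (plane R)) f /\ Lambda_norm p u f < +oo].

Definition Lambda2_norm (q : R) (w : R * R -> R) (f : R * R -> R) : \bar R :=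
  (\int[mu2]_(z in quadrant)
     (rearrangement_yx f z.1 z.2 `^ q * (w z)%:E)) `^ (q^-1).

Definition Lambda2 (q : R) (w : R * R -> R) : set (R * R -> R) :=
  [set f | measurable_fun (setT : set (plane R)) f /\ Lambda2_norm q w f < +oo].

(* For measurable f outside [Lambda p u] the right-hand side is +oo and there *)
(* is nothing to require; quantifying over [Lambda p u] makes this hold for   *)
(* c = 0 too, where the library has 0 * +oo = 0.                              *)
Definition embedding_constant (p q : R) (u : R -> R) (w : R * R -> R) (c : R) :
    Prop :=
  (0 <= c)%R /\
  forall f, Lambda p u f -> Lambda2_norm q w f <= c%:E * Lambda_norm p u f.

Definition embedded (p q : R) (u : R -> R) (w : R * R -> R) : Prop :=
  Lambda p u `<=` Lambda2 q w /\ exists c, embedding_constant p q u w c.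

Definition best_embedding_constant (p q : R) (u : R -> R) (w : R * R -> R)
    (c : R) : Prop :=
  embedding_constant p q u w c /\
  forall c', embedding_constant p q u w c' -> (c <= c')%R.

Definition decreasing_set (D : set (R * R)) : Prop :=
  [/\ D `<=` quadrant,
      forall s s' t, (0 < s)%R -> (s <= s')%R -> (0 < t)%R ->
        (\1_D (s', t) <= \1_D (s, t) :> R)%R
    & forall s t t', (0 < s)%R -> (0 < t)%R -> (t <= t')%R ->
        (\1_D (s, t') <= \1_D (s, t) :> R)%R].

(* |D| may be infinite.  The quotient follows the library conventions         *)
(* 0 / 0 = 0, a / 0 = +oo for a > 0, and a / +oo = 0 even when a = +oo: a     *)
(* vanishing numerator or an infinite denominator puts no constraint on the   *)
(* supremum.                                                                  *)
Definition decreasing_ratio (p q : R) (u : R -> R) (w : R * R -> R)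
    (D : set (R * R)) : \bar R :=
  (\int[mu2]_(z in D) (w z)%:E) `^ (q^-1) /
  (\int[mu1]_(t in [set t : R | (0 < t)%R /\ t%:E < mu2 D]) (u t)%:E)
    `^ (p^-1).

Definition decreasing_sup (p q : R) (u : R -> R) (w : R * R -> R) : \bar R :=
  ereal_sup [set decreasing_ratio p q u w D | D in decreasing_set].

End LorentzSpaces.

(* Main.v *)
Require Import Defs.
From mathcomp Require Import all_boot all_order all_algebra.
From mathcomp Require Import all_classical all_reals all_analysis.
From mathcomp Require Import measurable_realfun.

Set Implicit Arguments.
Unset Strict Implicit.
Unset Printing Implicit Defensive.

Import Order.TTheory GRing.Theory Num.Theory.
Import numFieldNormedType.Exports.

Local Open Scope classical_set_scope.
Local Open Scope ring_scope.

(** Let [D_l] be the part of the quadrant where [f^*_yx > l].  It is a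
    decreasing set, and it has the same measure as [{|f| > l}], because taking
    the decreasing rearrangement in one variable preserves the measures of the
    superlevel sets on almost every line, so that Tonelli's theorem applies
    twice ([mu2_rearr_set], [superlevel_rearrangement_yx]).

    Assume that the supremum [C] is finite.  Applied to [D_l], it gives
    [w(D_l)^(1/q) <= C * U(|{|f| > l}|)^(1/p)] for every [l > 0], with
    [U(t) = \int_0^t u], where the right-hand side involves the integral of [u]
    over [{f^* > l}].  Such level set estimates integrate to the
    norm inequality with the same constant ([weighted_level_set_inequality]):
    after raising functions to the power [p] one may take [p = 1] and
    [r = q/p >= 1], and the function to be estimated in [L^r(w)] is a limit of
    sums [\sum_i h * 1_{F > ih}]; Minkowski's inequality in [L^r] bounds the
    norm of such a sum by [C * \sum_i h * u{G > ih} <= C * \int G u], and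
    Fatou's lemma passes to the limit.

    Conversely, test an embedding of constant [c] on [f = 1_D] with [D]
    decreasing.  Then [f^*] is the indicator of [{t < |D|}] and [f^*_yx] is the
    indicator of the rearranged set of [D], which coincides with [D] up to a
    null set ([same2_rearr_set]): a decreasing set agrees with the region under
    the graph of the lengths of its vertical sections up to a part of this
    graph, graphs of measurable functions are null, and the same holds for
    horizontal sections.  This also shows that decreasing sets are Lebesgue
    measurable.  Hence the quotient of [D] is at most [c]
    ([ratio_le_embedding]). *)

(** * Lebesgue measure on the line and in the plane *)

Section measurable_hull.
Local Open Scope ereal_scope.
Context d (T : measurableType d) (R : realType) (mu : {measure set T -> \bar R}).

(** The outer measure of any set is attained on a measurable superset. *)
Lemma measurable_hull (X : set T) :
  exists G, [/\ measurable G, X `<=` G & mu G = mu^*%mu X].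
Proof.
have [Xoo|Xoo] := eqVneq (mu^*%mu X) +oo.
  exists setT; split => //; apply/eqP; rewrite Xoo -leye_eq -Xoo.
  by rewrite -(measurable_mu_extE mu)//; exact: le_outer_measure.
have Xfin : mu^*%mu X \is a fin_num.
  by rewrite ge0_fin_numE ?ltey// outer_measure_ge0.
have cover n : exists A, @measurable_cover _ T X A /\
    \sum_(0 <= k <oo) mu (A k) < mu^*%mu X + n.+1%:R^-1%:E.
  have n0 : (0 < n.+1%:R^-1 :> R)%R by rewrite invr_gt0.
  by have [_ [A XA <-] ?] := lb_ereal_inf_adherent n0 Xfin; exists A.
have [A /all_and2[XA ltA]] := choice cover.
exists (\bigcap_n \bigcup_k A n k).
have mA n : measurable (\bigcup_k A n k).
  by apply: bigcupT_measurable => k; case: (XA n).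
have mG : measurable (\bigcap_n \bigcup_k A n k) by exact: bigcapT_measurable.
have XG : X `<=` \bigcap_n \bigcup_k A n k.
  by move=> x Xx n _; case: (XA n) => _; exact.
split=> //; apply/eqP; rewrite eq_le; apply/andP; split; last first.
  by rewrite -(measurable_mu_extE mu mG); exact: le_outer_measure.
apply/lee_addgt0Pr => _/posnumP[e]; near \oo => n.
apply: (@le_trans _ _ (mu^*%mu X + n.+1%:R^-1%:E)); last first.
  rewrite leeD// lee_fin ltW//.
  by near: n; apply: near_infty_natSinv_lt.
apply/ltW/(le_lt_trans _ (ltA n)).
apply: measure_sigma_subadditive => //; first by case: (XA n).
by move=> x; exact.
Unshelve. all: by end_near. Qed.

End measurable_hull.

Lemma product_sigma_finite d1 d2 (T1 : measurableType d1)
    (T2 : measurableType d2) (R : realType)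
    (m1 : {sigma_finite_measure set T1 -> \bar R})
    (m2 : {sigma_finite_measure set T2 -> \bar R}) :
  sigma_finite setT (m1 \x m2)%E.
Proof.
have /sigma_finiteP[F [FT ndF Foo]] := sigma_finiteT m1.
have /sigma_finiteP[G [GT ndG Goo]] := sigma_finiteT m2.
exists (fun n => F n `*` G n) => [|n]; last first.
  have [[mF F_oo] [mG G_oo]] := (Foo n, Goo n).
  split; first exact: measurableX.
  by rewrite product_measure1E// lte_mul_pinfty// ge0_fin_numE.
apply/esym/seteqP; split => // -[x y] _.
have [i _ Fx] : (\bigcup_i F i) x by rewrite -FT.
have [j _ Gy] : (\bigcup_i G i) y by rewrite -GT.
exists (maxn i j) => //; split.
- exact: (subsetPset _ _ (ndF _ _ (leq_maxl i j))).
- exact: (subsetPset _ _ (ndG _ _ (leq_maxr i j))).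
Qed.

Section lebesgue_plane.
Local Open Scope ereal_scope.
Context {R : realType}.
Notation leb := (@lebesgue_measure R).
Notation leb2 := (leb \x leb).
Implicit Types (A B D N : set (R * R)).

Lemma mu1E (X : set R) : mu1 X = leb X. Proof. by []. Qed.

Lemma mu1_ge0 (X : set R) : 0 <= mu1 X.
Proof. exact: mu_ext_ge0. Qed.

Lemma le_mu1 (X Y : set R) : X `<=` Y -> mu1 X <= mu1 Y.
Proof. exact: (le_mu_ext (wlength (@idfun R))). Qed.

Lemma le_mu2 A B : A `<=` B -> mu2 A <= mu2 B.
Proof. exact: (le_mu_ext leb2). Qed.

Lemma mu2_ge0 A : 0 <= mu2 A.
Proof. exact: mu_ext_ge0. Qed.

Lemma le_mu1U (X Y : set R) : mu1 (X `|` Y) <= mu1 X + mu1 Y.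
Proof. exact: (outer_measureU2 ((wlength (@idfun R))^*)%mu). Qed.

Lemma le_mu2U A B : mu2 (A `|` B) <= mu2 A + mu2 B.
Proof. exact: (outer_measureU2 (leb2^*)%mu). Qed.

Lemma borel_line (X : set R) : measurable X -> measurable (X : set (line R)).
Proof. by move=> mX; exact: sub_caratheodory. Qed.

Lemma borel_plane B : measurable B -> measurable (B : set (plane R)).
Proof. by move=> mB; exact: (@caratheodory_measurable_mu_ext _ _ _ leb2). Qed.

Lemma mu2E B : measurable B -> mu2 B = leb2 B.
Proof. by move=> mB; exact: (measurable_mu_extE leb2). Qed.

Lemma null_line (X : set R) : mu1 X = 0 -> measurable (X : set (line R)).
Proof.
move=> X0; apply: (@le_caratheodory_measurable _ _ ((wlength (@idfun R))^*)%mu).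
move=> Y; have Z0 : mu1 (Y `&` X) = 0.
  by apply/eqP; rewrite eq_le mu1_ge0 andbT -X0; apply: le_mu1; exact: subIsetr.
by rewrite [X in X + _]Z0 add0e; apply: le_mu1; exact: subIsetl.
Qed.

Lemma null_plane N : mu2 N = 0 -> measurable (N : set (plane R)).
Proof.
move=> N0; apply: (@le_caratheodory_measurable _ _ (leb2^*)%mu) => Y.
have Z0 : mu2 (Y `&` N) = 0.
  by apply/eqP; rewrite eq_le mu2_ge0 andbT -N0; apply: le_mu2; exact: subIsetr.
by rewrite [X in X + _]Z0 add0e; apply: le_mu2; exact: subIsetl.
Qed.

Lemma sub_mu1_0 (X Y : set R) : X `<=` Y -> mu1 Y = 0 -> mu1 X = 0.
Proof. by move=> XY Y0; apply/eqP; rewrite eq_le mu1_ge0 -Y0 le_mu1. Qed.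

Lemma sub_mu2_0 A B : A `<=` B -> mu2 B = 0 -> mu2 A = 0.
Proof. by move=> AB B0; apply/eqP; rewrite eq_le mu2_ge0 -B0 le_mu2. Qed.

(** Equality of sets up to a null set.  The sets need not be measurable: [mu1]
    and [mu2] are the outer Lebesgue measures as functions of arbitrary sets,
    hence monotone and subadditive without any measurability assumption. *)
Definition same1 (X Y : set R) := mu1 (X `\` Y) = 0 /\ mu1 (Y `\` X) = 0.
Definition same2 A B := mu2 (A `\` B) = 0 /\ mu2 (B `\` A) = 0.

Lemma same1_mu (X Y : set R) : same1 X Y -> mu1 X = mu1 Y.
Proof.
have suf (X' Y' : set R) : mu1 (X' `\` Y') = 0 -> mu1 X' <= mu1 Y'.
  move=> X0; rewrite -[leRHS]adde0 -X0; apply: le_trans (le_mu1U _ _).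
  by apply: le_mu1 => x; have [|] := pselect (Y' x); [left|right].
by move=> [XY YX]; apply/eqP; rewrite eq_le !suf.
Qed.

Lemma same2_mu A B : same2 A B -> mu2 A = mu2 B.
Proof.
have suf (X' Y' : set (R * R)) : mu2 (X' `\` Y') = 0 -> mu2 X' <= mu2 Y'.
  move=> X0; rewrite -[leRHS]adde0 -X0; apply: le_trans (le_mu2U _ _).
  by apply: le_mu2 => x; have [|] := pselect (Y' x); [left|right].
by move=> [XY YX]; apply/eqP; rewrite eq_le !suf.
Qed.

Lemma setDDE T (X Y : set T) : X = (Y `\` (Y `\` X)) `|` (X `\` Y).
Proof.
apply/seteqP; split => x /=; have [Yx|nYx] := pselect (Y x).
- by move=> Xx; left; split => // -[].
- by move=> Xx; right.
- by case=> [[_ nYX]|[]//]; apply: contrapT => nXx; exact: nYX.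
- by case=> -[].
Qed.

Lemma same1_measurable (X Y : set R) : same1 X Y ->
  measurable (Y : set (line R)) -> measurable (X : set (line R)).
Proof.
move=> [XY YX] mY; rewrite (setDDE X Y).
apply: measurableU; last exact: null_line.
by apply: measurableD => //; exact: null_line.
Qed.

Lemma same2_measurable A B : same2 A B ->
  measurable (B : set (plane R)) -> measurable (A : set (plane R)).
Proof.
move=> [AB BA] mB; rewrite (setDDE A B).
apply: measurableU; last exact: null_plane.
by apply: measurableD => //; exact: null_plane.
Qed.

Lemma null_hull N : mu2 N = 0 ->
  exists M, [/\ measurable M, leb2 M = 0 & N `<=` M].
Proof.
by move=> N0; have [M [mM NM M0]] := measurable_hull leb2 N; exists M; rewrite M0.
Qed.

Lemma mu2_sigma_finite : sigma_finite setT (@mu2 R).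
Proof.
exact/completed_measure_extension_sigma_finite/(product_sigma_finite leb leb).
Qed.

Lemma mu2_bigcup0 (F : nat -> set (R * R)) :
  (forall n, mu2 (F n) = 0) -> mu2 (\bigcup_n F n) = 0.
Proof.
move=> F0; apply/eqP; rewrite eq_le mu2_ge0 andbT.
apply: (le_trans (outer_measure_sigma_subadditive (leb2^*)%mu F)).
by rewrite eseries0// => n _ _; exact: F0.
Qed.

(** Every Lebesgue measurable set is a Borel set up to a null set: inside each
    piece of finite measure it has the measure of its Borel hull. *)
Lemma plane_borel A : measurable (A : set (plane R)) ->
  exists2 B, measurable B & same2 A B.
Proof.
move=> mA; have [F FT mF] := mu2_sigma_finite.
have AF n : exists B, [/\ measurable B, A `&` F n `<=` B &
    mu2 (B `\` (A `&` F n)) = 0].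
  have [B [mB AB BE]] := measurable_hull leb2 (A `&` F n); exists B; split=> //.
  have BE' : mu2 B = mu2 (A `&` F n) by rewrite mu2E.
  have mAF : measurable (A `&` F n : set (plane R)).
    by apply: measurableI => //; case: (mF n).
  have AFoo : mu2 (A `&` F n) < +oo.
    by apply: le_lt_trans (mF n).2; apply: le_mu2; exact: subIsetr.
  rewrite measureD//; [|exact: borel_plane|by rewrite [ltLHS]BE'].
  by rewrite setIidr// [X in X - _]BE' subee// ge0_fin_numE// mu2_ge0.
have [B /all_and3[mB AB BA0]] := choice AF.
exists (\bigcup_n B n); first exact: bigcupT_measurable.
split.
  rewrite (_ : _ `\` _ = set0) ?measure0//.
  apply/seteqP; split => // x [Ax] []; have : [set: R * R] x by [].
  by rewrite FT => -[n _ Fx]; exists n => //; exact: AB.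
apply: (@sub_mu2_0 _ (\bigcup_n (B n `\` (A `&` F n)))); last exact: mu2_bigcup0.
by move=> x [[n _ Bx] nAx]; exists n => //; split => // -[].
Qed.

Lemma ae_mu1P (P : R -> Prop) : {ae mu1, forall x, P x} <-> mu1 (~` P) = 0.
Proof.
split=> [[N [mN N0 PN]]|P0]; first exact: sub_mu1_0 N0.
by exists (~` P); split => //; exact: null_line.
Qed.

(** The null set need not be Borel, so its sections are compared with those of
    a Borel null set containing it, to which Tonelli's theorem applies. *)
Lemma null_sections N : mu2 N = 0 ->
  {ae mu1, forall x, mu1 (xsection N x) = 0}.
Proof.
move=> /null_hull[M [mM M0 NM]].
have mphi := measurable_fun_xsection leb mM.
have : \int[leb]_x `|(leb \o xsection M) x| = 0.
  rewrite -[RHS]M0; apply: eq_integral => x _; rewrite gee0_abs//.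
move/(ae_eq_integral_abs leb measurableT mphi) => [Z [mZ Z0 ZM]].
exists Z; split; [exact: borel_line|exact: Z0|].
apply: subset_trans ZM => x /= nx h; apply: nx.
apply: sub_mu1_0 (h I) => y; rewrite /xsection/= !inE; exact: NM.
Qed.

Lemma same2_sections A B : same2 A B ->
  {ae mu1, forall x, same1 (xsection A x) (xsection B x)}.
Proof.
move=> [/null_sections AB /null_sections BA].
apply: (@filterS2 _ _ (ae_filter_ringOfSetsType (@mu1 R))) AB BA => x.
by rewrite !xsectionD.
Qed.

End lebesgue_plane.

(** * Superlevel sets of rearrangements *)

Section rearrangement_lemmas.
Local Open Scope ereal_scope.
Context {R : realType}.
Notation leb := (@lebesgue_measure R).
Notation leb2 := (leb \x leb).

(** The superlevel sets of a rearrangement are intervals starting at [0], of the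
    measure of those of the function.  The direction from right to left is the
    right continuity of the distribution function, which is where
    measurability is needed; it is only required at the levels
    [l + 1/(n+1)], because the sections of a measurable function of two
    variables are measurable only off a null set.  Monotonicity of [mu] on all
    sets is assumed because the infimum defining the rearrangement runs over
    levels at which the superlevel set may fail to be measurable. *)
Lemma lt_rearrangement d (T : measurableType d)
    (mu : {measure set T -> \bar R}) (f : T -> \bar R) (l t : R) :
  (forall X Y : set T, X `<=` Y -> mu X <= mu Y) ->
  (forall n, measurable [set x | (l + n.+1%:R^-1)%:E < `|f x|]) ->
  l%:E < rearrangement mu f t <-> t%:E < mu [set x | l%:E < `|f x|].
Proof.
move=> mono mE; pose E s := [set x | s%:E < `|f x|].
have subE s s' : (s <= s')%R -> E s' `<=` E s.
  by move=> ss' x; apply: le_lt_trans; rewrite lee_fin.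
split=> [lt_l|t_lt].
  rewrite ltNge; apply/negP => mut; move: lt_l; apply/negP; rewrite -leNgt.
  by apply: ereal_inf_lbound; exists l.
have EU : E l = \bigcup_n E (l + n.+1%:R^-1)%R.
  apply/seteqP; split => [x|x [n _]]; last by apply: subE; rewrite lerDl.
  rewrite /E/=; case fx : `|f x| => [r| |] //; last first.
    by move=> _; exists 0%N; rewrite //= fx ltry.
  rewrite lte_fin => /ltr_add_invr[n lnr].
  by exists n => //=; rewrite fx lte_fin.
have [n tn] : exists n, t%:E < mu (E (l + n.+1%:R^-1)%R).
  apply: contrapT => /forallNP nt; move: t_lt; apply/negP; rewrite -leNgt.
  rewrite -/(E l) EU.
  have mU : measurable (\bigcup_n E (l + n.+1%:R^-1)%R) by exact: bigcupT_measurable.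
  have ndE : nondecreasing_seq (fun n => E (l + n.+1%:R^-1)%R).
    move=> m n mn; apply/subsetPset/subE.
    by rewrite lerD2l lef_pV2 ?posrE// ler_nat ltnS.
  have cvgE := @nondecreasing_cvg_mu _ _ _ mu _ mE mU ndE.
  rewrite -(cvg_lim _ cvgE)//; apply: lime_le; first by apply/cvg_ex; eexists; exact: cvgE.
  by near=> n; rewrite /= leNgt; apply/negP/nt.
apply: (@lt_le_trans _ _ (l + n.+1%:R^-1)%:E); first by rewrite lte_fin ltrDl.
apply: le_ereal_inf_tmp => _ [s mus <-]; rewrite lee_fin leNgt; apply/negP => sl.
have := le_trans (mono _ _ (subE _ _ (ltW sl))) mus.
by rewrite leNgt tn.
Unshelve. all: by end_near. Qed.

Lemma rearrangement_ge0 (T : Type) (mu : set T -> \bar R) (f : T -> \bar R) t :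
  mu setT = +oo -> 0 <= rearrangement mu f t.
Proof.
move=> muT; apply: le_ereal_inf_tmp => _ [s mus <-].
rewrite lee_fin leNgt; apply/negP => s0.
move: mus => /=; rewrite (_ : [set x | _] = setT) ?muT ?leye_eq//.
apply/seteqP; split => // x _ /=.
by rewrite (@lt_le_trans _ _ 0)// lte_fin.
Qed.

(** The decreasing set obtained from [A] by replacing its vertical sections, and
    then the horizontal sections of the result, by intervals starting at [0] of
    the same length.  It is the superlevel set of an iterated rearrangement when
    [A] is the superlevel set of the function. *)
Definition rearr_set (A : set (R * R)) : set (R * R) :=
  [set z | [/\ (0 < z.1)%R, (0 < z.2)%R &
    z.1%:E < mu1 [set x | z.2%:E < mu1 (xsection A x)]]].

Lemma ae_same1 (P Q : set R) : {ae mu1, forall x, P x <-> Q x} -> same1 P Q.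
Proof.
move=> /ae_mu1P PQ0; split; apply: sub_mu1_0 PQ0 => x [Px Qx] /= PQ;
  by apply: Qx; apply/PQ.
Qed.

Lemma same2_dist (A B : set (R * R)) (t : R) : same2 A B ->
  same1 [set x | t%:E < mu1 (xsection A x)] [set x | t%:E < mu1 (xsection B x)].
Proof.
move=> /same2_sections AB; apply: ae_same1.
apply: (@filterS _ _ (ae_filter_ringOfSetsType (@mu1 R))) AB => x.
by move=> /same1_mu /= ->.
Qed.

Lemma rearr_set_same2 (A B : set (R * R)) : same2 A B -> rearr_set A = rearr_set B.
Proof.
move=> AB; apply/seteqP; split=> z [z1 z2 h]; split => //.
- by rewrite -(same1_mu (same2_dist _ AB)).
- by rewrite (same1_mu (same2_dist _ AB)).
Qed.

Lemma lebesgue_hypograph (b : \bar R) : 0 <= b ->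
  leb [set s | (0 < s)%R /\ s%:E < b] = b.
Proof.
case: b => [b| |]//= b0.
- rewrite (_ : [set _ | _] = [set` `]0%R, b[]); last first.
    apply/seteqP; split => s /=; rewrite in_itv/= lte_fin.
      by case=> -> ->.
    by move/andP.
  rewrite lebesgue_measure_itv/= lte_fin; case: ltP; first by rewrite sube0.
  by move=> b0'; apply/eqP; rewrite eq_le b0 lee_fin.
- rewrite (_ : [set _ | _] = [set` `]0%R, +oo[]).
    by rewrite lebesgue_measure_itv/= ltry.
  apply/seteqP; split => s /=; rewrite in_itv/= andbT; first by case.
  by move=> ?; rewrite ltry.
Qed.

Lemma leb2_xsection (B : set (R * R)) : leb2 B = \int[leb]_x leb (xsection B x).
Proof. by []. Qed.

Lemma leb2_ysection (B : set (R * R)) : measurable B ->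
  leb2 B = \int[leb]_y leb (ysection B y).
Proof.
move=> mB; have -> : leb2 B = (leb \x^ leb) B.
  by apply: product_measure_unique => //= *; rewrite product_measure2E.
by [].
Qed.

Lemma measurable_efst : measurable_fun setT (EFin \o fst : R * R -> \bar R).
Proof. by apply/measurable_EFinP; exact: measurable_fst. Qed.

Lemma measurable_esnd : measurable_fun setT (EFin \o snd : R * R -> \bar R).
Proof. by apply/measurable_EFinP; exact: measurable_snd. Qed.

Lemma measurable_pos1 : measurable [set z : R * R | (0 < z.1)%R].
Proof.
by have := emeasurable_fun_o_infty measurableT measurable_efst 0; rewrite setTI.
Qed.

Lemma measurable_pos2 : measurable [set z : R * R | (0 < z.2)%R].
Proof.
by have := emeasurable_fun_o_infty measurableT measurable_esnd 0; rewrite setTI.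
Qed.

Lemma measurable_quadrant : measurable (@quadrant R).
Proof. exact: measurableI measurable_pos1 measurable_pos2. Qed.

Lemma measurable_below_x (b : R -> \bar R) : measurable_fun setT b ->
  measurable [set z : R * R | z.2%:E < b z.1].
Proof.
move=> mb.
have := @measurable_lte _ _ _ [set: R * R] measurableT (EFin \o snd) (b \o fst).
rewrite setTI; apply; first exact: measurable_esnd.
by apply: measurableT_comp => //; exact: measurable_fst.
Qed.

Lemma measurable_below_y (b : R -> \bar R) : measurable_fun setT b ->
  measurable [set z : R * R | z.1%:E < b z.2].
Proof.
move=> mb.
have := @measurable_lte _ _ _ [set: R * R] measurableT (EFin \o fst) (b \o snd).
rewrite setTI; apply; first exact: measurable_efst.
by apply: measurableT_comp => //; exact: measurable_snd.
Qed.

(** Rearranging a Borel set preserves its measure: [S] is the region under the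
    graph of [x |-> |B_x|], the rearranged set is the region under the graph of
    the lengths of the horizontal sections of [S], and each step preserves the
    integral of the lengths of the sections. *)
Lemma rearr_set_borel (B : set (R * R)) : measurable B ->
  measurable (rearr_set B) /\ leb2 (rearr_set B) = leb2 B.
Proof.
move=> mB.
pose b := leb \o xsection B.
have mb : measurable_fun setT b by exact: measurable_fun_xsection.
pose S : set (R * R) := [set z | (0 < z.2)%R /\ z.2%:E < b z.1].
have mS : measurable S.
  by apply: measurableI; [exact: measurable_pos2|exact: measurable_below_x].
pose d := leb \o ysection S.
have md : measurable_fun setT d by exact: measurable_fun_ysection.
have -> : rearr_set B = [set z | (0 < z.1)%R /\ z.1%:E < d z.2].
  have dE t : (0 < t)%R -> d t = mu1 [set x | t%:E < mu1 (xsection B x)].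
    move=> t0; rewrite mu1E; congr (leb _).
    by apply/seteqP; split => x /=; rewrite /ysection/= inE; [case|].
  have dE0 t : (t <= 0)%R -> d t = 0.
    move=> t0; rewrite /d/= (_ : ysection _ _ = set0) ?measure0//.
    apply/seteqP; split => // x; rewrite /ysection/= inE => -[]/=.
    by rewrite ltNge t0.
  apply/seteqP; split => [z [z1 z2 h]|z [z1 h]]; first by split=> //; rewrite dE.
  have z2 : (0 < z.2)%R.
    rewrite ltNge; apply/negP => /dE0 d0; move: h; rewrite d0 lte_fin ltNge.
    by rewrite (ltW z1).
  by split => //; rewrite -dE.
have mr : measurable [set z : R * R | (0 < z.1)%R /\ z.1%:E < d z.2].
  by apply: measurableI; [exact: measurable_pos1|exact: measurable_below_y].
split=> //; rewrite (leb2_ysection mr) leb2_xsection.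
transitivity (leb2 S).
  rewrite (leb2_ysection mS); apply: eq_integral => t _.
  rewrite -[RHS](@lebesgue_hypograph (leb (ysection S t))) ?measure_ge0//.
  by congr (leb _); apply/seteqP; split => x /=; rewrite /ysection/= inE.
rewrite leb2_xsection; apply: eq_integral => x _.
rewrite -[RHS](@lebesgue_hypograph (leb (xsection B x))) ?measure_ge0//.
by congr (leb _); apply/seteqP; split => y /=; rewrite /xsection/= inE.
Qed.

Lemma rearr_set_measurable (A : set (R * R)) : measurable (A : set (plane R)) ->
  measurable (rearr_set A : set (plane R)).
Proof.
move=> /plane_borel[B mB AB]; rewrite (rearr_set_same2 AB).
by apply: borel_plane; case: (rearr_set_borel mB).
Qed.

Lemma mu2_rearr_set (A : set (R * R)) : measurable (A : set (plane R)) ->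
  mu2 (rearr_set A) = mu2 A.
Proof.
move=> /plane_borel[B mB AB]; rewrite (rearr_set_same2 AB) (same2_mu AB).
by have [mr rE] := rearr_set_borel mB; rewrite !mu2E.
Qed.

Lemma mu1_setT : mu1 [set: R] = +oo.
Proof.
by rewrite mu1E (_ : setT = [set` `]-oo, +oo[%R]) ?lebesgue_measure_itv ?set_itvE.
Qed.

Lemma mu2_setT : mu2 [set: R * R] = +oo.
Proof.
rewrite mu2E// -setXTT product_measure1E//.
transitivity (+oo * +oo : \bar R); last by rewrite mulyy.
by congr (_ * _); exact: mu1_setT.
Qed.

Lemma measurable_abse_gt d (T : measurableType d) (f : T -> R) l :
  measurable_fun setT f -> measurable [set z | l%:E < `|(f z)%:E|].
Proof.
move=> mf; have : measurable_fun setT (fun z => `|(f z)%:E|).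
  by apply: measurableT_comp => //; exact/measurable_EFinP.
by move/emeasurable_fun_o_infty => /(_ measurableT l%:E); rewrite setTI.
Qed.

(** The set where [|f| > l], written with the extended-real absolute value that
    occurs in the definition of rearrangements. *)
Definition superlevel (f : R * R -> R) (l : R) : set (R * R) :=
  [set z | l%:E < `|(f z)%:E|].

Lemma superlevel_measurable f l : measurable_fun (setT : set (plane R)) f ->
  measurable (superlevel f l : set (plane R)).
Proof.
exact: (@measurable_abse_gt _ (plane R)).
Qed.

Lemma lt_rearrangement2 f l t : measurable_fun (setT : set (plane R)) f ->
  l%:E < rearrangement mu2 (EFin \o f) t <-> t%:E < mu2 (superlevel f l).
Proof.
move=> mf; apply: (@lt_rearrangement _ (plane R) mu2) => [|n]; first exact: le_mu2.
exact: superlevel_measurable.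
Qed.

Lemma dist_measurable (A : set (R * R)) (t : R) :
  measurable (A : set (plane R)) ->
  measurable ([set x | t%:E < mu1 (xsection A x)] : set (line R)).
Proof.
move=> /plane_borel[B mB AB].
apply: (same1_measurable (same2_dist t AB)); apply: borel_line.
have := measurable_fun_xsection leb mB.
by move/emeasurable_fun_o_infty => /(_ measurableT t%:E); rewrite setTI.
Qed.

Lemma section_measurable (A : set (R * R)) : measurable (A : set (plane R)) ->
  {ae mu1, forall x, measurable (xsection A x : set (line R))}.
Proof.
move=> /plane_borel[B mB /same2_sections AB].
apply: (@filterS _ _ (ae_filter_ringOfSetsType (@mu1 R))) AB => x AB.
apply: same1_measurable AB _; apply: borel_line.
exact: measurable_xsection.
Qed.

(** Almost every section of [f] is measurable at the countably many levels that
    [lt_rearrangement] requires. *)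
Lemma lt_rearrangement_y f l t : measurable_fun (setT : set (plane R)) f ->
  {ae mu1, forall x,
    l%:E < rearrangement mu1 (fun y => (f (x, y))%:E) t <->
    t%:E < mu1 (xsection (superlevel f l) x)}.
Proof.
move=> mf.
have sE l' x : xsection (superlevel f l') x = [set y | l'%:E < `|(f (x, y))%:E|].
  by apply/seteqP; split => y /=; rewrite /xsection/= inE.
have := ae_foralln (fun n => section_measurable
  (@superlevel_measurable f (l + n.+1%:R^-1) mf)).
apply: (@filterS _ _ (ae_filter_ringOfSetsType (@mu1 R))) => x mx.
rewrite sE; apply: (@lt_rearrangement _ (line R) mu1) => [|n]; first exact: le_mu1.
by have := mx n; rewrite sE.
Qed.

Lemma lt_rearrangement_yx f l s t : measurable_fun (setT : set (plane R)) f ->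
  (0 <= l)%R ->
  l%:E < rearrangement_yx f s t <->
  s%:E < mu1 [set x | t%:E < mu1 (xsection (superlevel f l) x)].
Proof.
move=> mf l0.
pose G x := rearrangement mu1 (fun y => (f (x, y))%:E) t.
(* the null set of x with a bad section is invisible to the outer rearrangement *)
have absG x : `|G x| = G x.
  by rewrite gee0_abs//; apply: rearrangement_ge0; exact: mu1_setT.
have same l' : same1 [set x | l'%:E < `|G x|]
    [set x | t%:E < mu1 (xsection (superlevel f l') x)].
  apply: ae_same1; have := lt_rearrangement_y l' t mf.
  apply: (@filterS _ _ (ae_filter_ringOfSetsType (@mu1 R))) => x /=.
  by rewrite absG.
rewrite -(same1_mu (same l)).
apply: (@lt_rearrangement _ (line R) mu1) => [|n]; first exact: le_mu1.
by apply: (same1_measurable (same _)); exact/dist_measurable/superlevel_measurable.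
Qed.

Lemma superlevel_rearrangement_yx f l :
  measurable_fun (setT : set (plane R)) f -> (0 <= l)%R ->
  quadrant `&` [set z | l%:E < rearrangement_yx f z.1 z.2] =
  rearr_set (superlevel f l).
Proof.
move=> mf l0; apply/seteqP; split => [z [[z1 z2] h]|z [z1 z2 h]].
  by split => //; apply/lt_rearrangement_yx.
by split => //; apply/lt_rearrangement_yx.
Qed.

End rearrangement_lemmas.

(** * Staircase approximation *)

Section level_sets.
Local Open Scope ereal_scope.
Context {R : realType}.

Lemma lee_real_lt (l m : \bar R) :
  (forall c : R, c%:E < l -> c%:E <= m) -> l <= m.
Proof.
move=> lm; rewrite leNgt; apply/negP => ml.
have [c mc cl] : exists2 c : R, m < c%:E & c%:E < l.
  case: m ml {lm} => [m| |]//; case: l => [l| |]//.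
  - rewrite lte_fin => ml; exists ((m + l) / 2)%R.
      by rewrite lte_fin midf_lt.
    by rewrite lte_fin midf_lt.
  - by move=> _; exists (m + 1)%R; rewrite ?ltry// lte_fin ltrDl.
  - by move=> _; exists (l - 1)%R; rewrite ?ltNyr// lte_fin gtrBl.
  - by move=> _; exists 0%R; rewrite ?ltry ?ltNyr.
by have := lm _ cl; rewrite leNgt mc.
Qed.

Lemma limn_einf_eq (v : (\bar R)^nat) (l : \bar R) :
  (forall n, v n <= l) ->
  (forall c : R, c%:E < l -> \forall n \near \oo, c%:E <= v n) ->
  limn_einf v = l.
Proof.
move=> vl lv; rewrite limn_einf_lim (cvg_lim _ (@cvg_einfs_sup _ v))//.
apply/eqP; rewrite eq_le; apply/andP; split.
  apply: ge_ereal_sup => _ [n _ <-]; apply: le_trans (vl n).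
  by apply: ereal_inf_lbound; exists n => /=.
apply: lee_real_lt => c cl.
have [N _ Nv] := lv _ cl.
apply: (@le_trans _ _ (einfs v N)); last by apply: ereal_sup_ubound; exists N.
by apply: le_ereal_inf_tmp => _ [n /= Nn <-]; exact: Nv.
Qed.

Lemma le_limn_einf (v : (\bar R)^nat) (l : \bar R) :
  (forall n, v n <= l) -> limn_einf v <= l.
Proof.
move=> vl; rewrite limn_einf_lim (cvg_lim _ (@cvg_einfs_sup _ v))//.
apply: ge_ereal_sup => _ [n _ <-]; apply: le_trans (vl n).
by apply: ereal_inf_lbound; exists n => /=.
Qed.

Lemma lee_poweR (r : R) (x y : \bar R) : (0 <= r)%R -> 0 <= x -> x <= y ->
  x `^ r <= y `^ r.
Proof.
move=> r0 x0 xy; apply: gt0_ler_poweR => //; rewrite in_itv/= ?x0 leey//.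
by rewrite (le_trans x0).
Qed.

Lemma poweRK (r : R) (x : \bar R) : (0 < r)%R -> 0 <= x -> (x `^ r) `^ r^-1 = x.
Proof. by move=> r0 x0; rewrite -poweRrM divff ?gt_eqF// poweRe1. Qed.

Lemma poweRVK (r : R) (x : \bar R) : (0 < r)%R -> 0 <= x -> (x `^ r^-1) `^ r = x.
Proof. by move=> r0 x0; rewrite -poweRrM mulVf ?gt_eqF// poweRe1. Qed.

(** The staircase with [N] steps of width and height [h] below the identity; it
    is evaluated at [F z], and then becomes a sum of indicators of superlevel
    sets of [F]. *)
Definition stair (h : R) (N : nat) (x : \bar R) : R :=
  (\sum_(i < N) h * ((i.+1%:R * h)%R%:E < x)%E%:R)%R.

Lemma stair_full h N x : (0 <= h)%R -> (N%:R * h)%:E < x ->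
  stair h N x = (N%:R * h)%R.
Proof.
move=> h0; elim: N => [_|N IH Nx]; first by rewrite /stair big_ord0 mul0r.
rewrite /stair big_ord_recr/= -/(stair h N x) IH; last first.
  by apply: le_lt_trans Nx; rewrite lee_fin ler_wpM2r// ler_nat.
by rewrite Nx mulr1 -natr1 mulrDl mul1r.
Qed.

Lemma stairS h N x : (0 <= h)%R -> (stair h N x <= stair h N.+1 x)%R.
Proof.
by move=> h0; rewrite /stair big_ord_recr/= lerDl mulr_ge0// ler0n.
Qed.

Lemma stair_le h N x : (0 <= h)%R -> 0 <= x -> (stair h N x)%:E <= x.
Proof.
move=> h0 x0; elim: N => [|N IH]; first by rewrite /stair big_ord0.
have [Nx|xN] := ltP (N.+1%:R * h)%:E x; first by rewrite stair_full// ltW.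
by rewrite /stair big_ord_recr/= ltNge xN/= mulr0 addr0.
Qed.

Lemma stair_ge h N (x : R) : (0 <= h)%R -> (x <= N%:R * h)%R ->
  (x - h <= stair h N x%:E)%R.
Proof.
move=> h0; elim: N => [|N IH] xN.
  by rewrite /stair big_ord0 lerBlDl addr0 (le_trans xN)// mul0r.
have [xN'|Nx] := leP x (N%:R * h)%R; first exact: le_trans (IH xN') (stairS _ _ h0).
apply: le_trans (stairS _ _ h0); rewrite stair_full// lerBlDr.
by rewrite (le_trans xN)// -natr1 mulrDl mul1r.
Qed.

(** Steps of width [1/(n+1)] up to height [n+1]. *)
Lemma stair_lim (x : \bar R) (y : R) : y%:E < x ->
  \forall n \near \oo, (y < stair n.+1%:R^-1 (n.+1 * n.+1) x)%R.
Proof.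
move=> yx.
have full (n : nat) : (n.+1%:R : R)%:E < x ->
    stair n.+1%:R^-1 (n.+1 * n.+1) x = n.+1%:R.
  by move=> nx; rewrite stair_full// natrM mulfK.
have yn : \forall n \near \oo, (y < n.+1%:R)%R.
  near=> n; apply: le_lt_trans (ler_norm _) _.
  by apply: lt_trans (_ : n%:R < _)%R; rewrite ?ltr_nat//; near: n;
     exact: nbhs_infty_gtr.
case: x yx full => [x| |]// yx full; last first.
  by near=> n; rewrite full ?ltry//; near: n.
near=> n; have [xn|nx] := leP x n.+1%:R; last by rewrite full//; near: n.
apply: lt_le_trans (stair_ge _ _); last by rewrite natrM mulfK.
  rewrite ltrBrDl -ltrBrDr; near: n.
  have xy : (0 < x - y)%R by rewrite subr_gt0 -lte_fin.
  exact: (near_infty_natSinv_lt (PosNum xy)).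
by [].
Unshelve. all: by end_near. Qed.

Section minkowski_sum.
Context d (T : measurableType d) (mu : {measure set T -> \bar R}).

Lemma minkowski_sum (r : R) (N : nat) (g : nat -> T -> R) : (1 <= r)%R ->
  (forall i, measurable_fun setT (g i)) ->
  Lnorm mu r%:E (EFin \o (fun z => \sum_(i < N) g i z)%R) <=
  \sum_(i < N) Lnorm mu r%:E (EFin \o g i).
Proof.
move=> r1 mg; elim: N => [|N IH].
  rewrite big_ord0 (_ : _ \o _ = cst 0) ?Lnorm0//.
    by rewrite eqe gt_eqF// (lt_le_trans _ r1).
  by apply/funext => z; rewrite /= big_ord0.
rewrite big_ord_recr/=; apply: le_trans (leeD2r _ IH).
rewrite (_ : _ \o _ = EFin \o ((fun z => \sum_(i < N) g i z) \+ g N)%R).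
  by apply: minkowski_EFin => //; exact: measurable_sum.
by apply/funext => z; rewrite /= big_ord_recr.
Qed.

End minkowski_sum.

End level_sets.

(** * From level set estimates to norm inequalities *)

Section level_set_inequality.
Local Open Scope ereal_scope.
Context {R : realType} d d' (T : measurableType d) (S : measurableType d').
Context (mu : {measure set T -> \bar R}) (nu : {measure set S -> \bar R}).

Lemma Lnorm_indic (w : T -> R) (A : set T) (h r : R) :
  (0 < r)%R -> (0 <= h)%R -> measurable A -> measurable_fun setT w ->
  (forall z, 0 <= w z)%R ->
  Lnorm mu r%:E (fun z => (h * (\1_A z * w z `^ r^-1))%R%:E) =
  h%:E * (\int[mu]_(z in A) (w z)%:E) `^ r^-1.
Proof.
move=> r0 h0 mA mw w0; rewrite unlock /Lnorm.
have -> : \int[mu]_x `|(h * (\1_A x * w x `^ r^-1))%R%:E| `^ r =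
          (h `^ r)%:E * \int[mu]_(z in A) (w z)%:E.
  rewrite [in RHS]integral_mkcond -ge0_integralZl_EFin ?powR_ge0//.
  - apply: eq_integral => z _.
    rewrite gee0_abs ?lee_fin ?mulr_ge0 ?powR_ge0// poweR_EFin.
    rewrite powRM ?mulr_ge0 ?powR_ge0// powRM ?powR_ge0//.
    rewrite -powRrM mulVf ?gt_eqF// powRr1// indicE patchE.
    case: (z \in A); first by rewrite powR1 mul1r EFinM.
    by rewrite powR0 ?gt_eqF// mul0r mulr0 mule0.
  - by move=> z _; rewrite patchE; case: ifP => //; rewrite lee_fin.
  - by apply/(measurable_restrictT _ mA)/measurable_EFinP/measurable_funTS.
rewrite poweRM ?lee_fin ?powR_ge0//; last first.
  by apply: integral_ge0 => z _; rewrite lee_fin.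
by rewrite -poweR_EFin poweRK.
Qed.

(** The case [p = 1], with everywhere defined nonnegative weights: the level set
    estimates say that the indicators of the superlevel sets of [F] have their
    [L^r(w)] norms controlled by the [L^1(u)] norms of those of [G]. *)
Lemma level_set_inequality (F : T -> \bar R) (G : S -> \bar R)
    (w : T -> R) (u : S -> R) (r C : R) :
  (1 <= r)%R -> (0 <= C)%R ->
  measurable_fun setT w -> (forall z, 0 <= w z)%R ->
  measurable_fun setT u -> (forall t, 0 <= u t)%R ->
  measurable_fun setT F -> (forall z, 0 <= F z) ->
  measurable_fun setT G -> (forall t, 0 <= G t) ->
  (forall l : R, (0 < l)%R ->
    (\int[mu]_(z in [set z | l%:E < F z]) (w z)%:E) `^ r^-1 <=
    C%:E * \int[nu]_(t in [set t | l%:E < G t]) (u t)%:E) ->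
  (\int[mu]_z (F z `^ r * (w z)%:E)) `^ r^-1 <=
  C%:E * \int[nu]_t (G t * (u t)%:E).
Proof.
move=> r1 C0 mw w0 mu_ u0 mF F0 mG G0 FG.
have r0 : (0 < r)%R by exact: lt_le_trans r1.
set K := C%:E * _.
have K0 : 0 <= K.
  by rewrite mule_ge0 ?lee_fin// integral_ge0// => t _; rewrite mule_ge0 ?lee_fin.
have mFl (l : R) : measurable [set z | l%:E < F z].
  by have := emeasurable_fun_o_infty measurableT mF l%:E; rewrite setTI.
have mGl (l : R) : measurable [set t | l%:E < G t].
  by have := emeasurable_fun_o_infty measurableT mG l%:E; rewrite setTI.
pose h (n : nat) : R := n.+1%:R^-1%R.
have h0 n : (0 < h n)%R by rewrite invr_gt0.
have h0' n : (0 <= h n)%R by exact/ltW.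
pose A n (i : nat) := [set z | (i.+1%:R * h n)%R%:E < F z].
pose B n (i : nat) := [set t | (i.+1%:R * h n)%R%:E < G t].
pose g n i z := (h n * (\1_(A n i) z * w z `^ r^-1))%R.
pose Phi n z := (\sum_(i < n.+1 * n.+1) g n i z)%R.
have mg n i : measurable_fun setT (g n i).
  apply: measurable_funM => //; apply: measurable_funM.
    exact/measurable_indic/mFl.
  exact: (measurableT_comp (measurable_powR _) mw).
have mPhi n : measurable_fun setT (Phi n) by exact: measurable_sum.
have PhiE n z : Phi n z = (stair (h n) (n.+1 * n.+1) (F z) * w z `^ r^-1)%R.
  rewrite /Phi /stair mulr_suml; apply: eq_bigr => i _.
  rewrite /g -mulrA indicE; congr (_ * (_%:R * _))%R.
  by congr nat_of_bool; apply/idP/idP; rewrite inE.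
have stair0 n N z : (0 <= stair (h n) N (F z))%R.
  by apply: sumr_ge0 => i _; rewrite mulr_ge0.
have Phi0 n z : (0 <= Phi n z)%R by rewrite PhiE mulr_ge0 ?powR_ge0.
(* Minkowski's inequality turns the level set estimates into a bound for *)
(* the staircase functions, uniform in n.                                *)
have PhiK n : \int[mu]_z ((Phi n z)%:E `^ r) <= K `^ r.
  have : Lnorm mu r%:E (EFin \o Phi n) <= K.
    apply: le_trans (minkowski_sum _ _ _ _) _ => //.
    apply: (@le_trans _ _ (\sum_(i < n.+1 * n.+1)
        C%:E * \int[nu]_t ((h n)%:E * ((\1_(B n i) t)%:E * (u t)%:E)))).
      apply: lee_sum => i _; rewrite /comp/= Lnorm_indic//; last exact: mFl.
      rewrite ge0_integralZl_EFin//; last 2 first.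
      - by move=> t _; rewrite mule_ge0 ?lee_fin.
      - by apply: emeasurable_funM; apply/measurable_EFinP => //;
          exact/measurable_indic/mGl.
      rewrite muleCA; apply: lee_wpmul2l; first by rewrite lee_fin ltW.
      have ih0 : (0 < i.+1%:R * h n)%R by rewrite mulr_gt0.
      apply: le_trans (FG _ ih0) _; rewrite lee_wpmul2l ?lee_fin//.
      rewrite integral_mkcond le_eqVlt; apply/orP; left; apply/eqP.
      apply: eq_integral => t _; rewrite patchE indicE.
      by case: ifPn => _; rewrite ?mul1e ?mul0e.
    rewrite -ge0_sume_distrr; last first.
      move=> i _; apply: integral_ge0 => t _.
      by rewrite !mule_ge0 ?lee_fin.
    rewrite lee_wpmul2l ?lee_fin// -ge0_integral_sum//; last 2 first.
    - move=> i; apply: emeasurable_funM => //; apply: emeasurable_funM;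
        apply/measurable_EFinP => //; exact/measurable_indic/mGl.
    - by move=> i t _; rewrite !mule_ge0 ?lee_fin.
    have sumE t : \sum_(i < n.+1 * n.+1) (h n)%:E * ((\1_(B n i) t)%:E * (u t)%:E) =
        (stair (h n) (n.+1 * n.+1) (G t))%:E * (u t)%:E.
      rewrite -EFinM /stair mulr_suml -sumEFin; apply: eq_bigr => i _.
      rewrite -!EFinM -mulrA indicE; congr (_ * (_%:R * _))%:E.
      by congr nat_of_bool; apply/idP/idP; rewrite inE.
    apply: ge0_le_integral => //.
    - by move=> t _; apply: sume_ge0 => i _; rewrite !mule_ge0 ?lee_fin.
    - apply: emeasurable_sum => i; apply: emeasurable_funM => //;
        apply: emeasurable_funM;
        apply/measurable_EFinP => //; exact/measurable_indic/mGl.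
    - by apply: emeasurable_funM => //; exact/measurable_EFinP.
    - by move=> t _; rewrite sumE lee_wpmul2r ?lee_fin ?stair_le.
  rewrite unlock /Lnorm => le_K.
  rewrite -(@poweRVK _ r (\int[mu]_z _)) ?integral_ge0// => [|z _]; last first.
    exact: poweR_ge0.
  apply: lee_poweR; [exact: ltW|exact: poweR_ge0|].
  apply: le_trans le_K; apply: lee_poweR.
  - by rewrite invr_ge0 ltW.
  - by apply: integral_ge0 => z _; exact: poweR_ge0.
  - apply: ge0_le_integral => //.
    + by move=> z _; exact: poweR_ge0.
    + by apply: (measurableT_comp (measurable_poweR _)); exact/measurable_EFinP.
    + apply: (measurableT_comp (measurable_poweR _)); apply: measurableT_comp => //.
      exact/measurable_EFinP.
    + by move=> z _; rewrite gee0_abs// lee_fin.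
(* Phi n stays below F * w^(1/r) and converges to it pointwise; the limit is *)
(* identified through the real numbers below it, so no continuity of the      *)
(* power function is used.                                                    *)
have PhiF z : limn_einf (fun n => (Phi n z)%:E `^ r) = F z `^ r * (w z)%:E.
  have aE : (w z)%:E = (w z `^ r^-1)%:E `^ r.
    by rewrite poweR_EFin -powRrM mulVf ?gt_eqF// powRr1.
  rewrite aE -poweRM ?lee_fin ?powR_ge0//.
  set a := (w z `^ r^-1)%R; have a0 : (0 <= a)%R by exact: powR_ge0.
  apply: limn_einf_eq => [n|c cF].
    apply: lee_poweR; [exact: ltW|by rewrite lee_fin|].
    by rewrite PhiE EFinM lee_wpmul2r// ?lee_fin// stair_le.
  (* for c >= 0, the condition c < (F z * a)^r amounts to c^(1/r) / a < F z *)
  have [c0|c0] := ltP c 0%R.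
    by apply: nearW => n; apply: le_trans (poweR_ge0 _ _); rewrite lee_fin ltW.
  pose y := (c `^ r^-1)%R; have y0 : (0 <= y)%R by exact: powR_ge0.
  have cE : c%:E = y%:E `^ r.
    by rewrite poweR_EFin -powRrM mulVf ?gt_eqF// powRr1.
  have yFa : y%:E < F z * a%:E.
    rewrite ltNge; apply/negP => Fay; move: cF; apply/negP; rewrite -leNgt cE.
    by apply: lee_poweR => //; [exact: ltW|rewrite mule_ge0 ?lee_fin].
  have a_gt0 : (0 < a)%R.
    rewrite lt_neqAle a0 andbT; apply/negP => /eqP a00.
    by move: yFa; rewrite -a00 mule0 lte_fin ltNge y0.
  have yaF : (y / a)%:E < F z by rewrite EFinM lte_pdivrMr.
  have := stair_lim yaF; apply: filterS => n yn.
  rewrite cE; apply: lee_poweR; [exact: ltW|by rewrite lee_fin|].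
  by rewrite lee_fin PhiE -ler_pdivrMr// ltW.
rewrite -[leRHS](@poweRK _ r)//; apply: lee_poweR.
- by rewrite invr_ge0 ltW.
- by apply: integral_ge0 => z _; rewrite mule_ge0 ?poweR_ge0 ?lee_fin.
under eq_integral do rewrite -PhiF.
apply: (le_trans (fatou _ _ _ _)) => //.
- by move=> n; apply: (measurableT_comp (measurable_poweR _)); exact/measurable_EFinP.
- by move=> n z _; exact: poweR_ge0.
- exact: le_limn_einf.
Qed.

End level_set_inequality.

Section weighted_level_sets.
Local Open Scope ereal_scope.
Context {R : realType}.

Lemma measurable_fun_superlevel d (T : measurableType d) (f : T -> \bar R) :
  (forall l : R, measurable [set x | l%:E < f x]) -> measurable_fun setT f.
Proof.
move=> mf; apply: (measurability _ (ErealGenOInfty.measurableE R)) => _ [_ [l ->] <-].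
rewrite setTI (_ : _ @^-1` _ = [set x | l%:E < f x])//.
by apply/seteqP; split => x /=; rewrite in_itv/= andbT.
Qed.

Lemma lt_poweR (p l : R) (x : \bar R) : (0 < p)%R -> (0 <= l)%R -> 0 <= x ->
  (l%:E < x `^ p) = ((l `^ p^-1)%:E < x).
Proof.
move=> p0 l0 x0; have lE : l%:E = (l `^ p^-1)%:E `^ p.
  by rewrite poweR_EFin -powRrM mulVf ?gt_eqF// powRr1.
have pV0 : (0 <= p^-1)%R by rewrite invr_ge0 ltW.
rewrite !ltNge; congr (~~ _); apply/idP/idP => [xl|xl].
  rewrite -(poweRK p0 x0) -poweR_EFin; apply: lee_poweR => //.
  exact: poweR_ge0.
by rewrite lE; apply: lee_poweR => //; exact: ltW.
Qed.

Context d d' (T : measurableType d) (S : measurableType d').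
Context (mu : {measure set T -> \bar R}) (nu : {measure set S -> \bar R}).

Lemma measurable_restrict_superlevel d0 (U : measurableType d0) (D : set U)
    (f : U -> \bar R) :
  (forall z, 0 <= f z) ->
  (forall l : R, (0 <= l)%R -> measurable (D `&` [set z | l%:E < f z])) ->
  measurable_fun setT (f \_ D).
Proof.
move=> f0 mf; apply: measurable_fun_superlevel => l.
have [l0|l0] := leP 0%R l.
  rewrite (_ : [set x | _] = D `&` [set z | l%:E < f z]); first exact: mf.
  apply/seteqP; split => z /=; rewrite patchE.
    by case: ifPn => [|_]; [rewrite inE|rewrite lte_fin ltNge l0].
  by move=> [Dz lf]; rewrite mem_set.
rewrite (_ : [set x | _] = setT)//; apply/seteqP; split => // z _ /=.
by rewrite patchE; case: ifP => _; rewrite ?lte_fin// (@lt_le_trans _ _ 0)// lte_fin.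
Qed.

Lemma patch_ge0 (U : Type) (D : set U) (v : U -> R) :
  (forall z, D z -> 0 <= v z)%R -> forall z, (0 <= (v \_ D) z)%R.
Proof. by move=> v0 z; rewrite patchE; case: ifPn => //; rewrite inE; exact: v0. Qed.

Lemma superlevel_patch (U : Type) (D : set U) (f : U -> \bar R) (p l : R) :
  (0 < p)%R -> (0 < l)%R -> (forall z, 0 <= f z) ->
  [set z | l%:E < (f \_ D) z `^ p] = D `&` [set z | (l `^ p^-1)%:E < f z].
Proof.
move=> p0 l0 f0; apply/seteqP; split => z /=.
  rewrite patchE; case: ifPn; first by rewrite inE lt_poweR// ltW.
  by rewrite poweR0r ?gt_eqF// lte_fin ltNge ltW.
by move=> [Dz lf]; rewrite patchE mem_set// lt_poweR// ltW.
Qed.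

(** Reduction to the previous inequality by the substitution
    [F^p], [G^p], [C^p], [r = q/p], extending all functions by [0]. *)
Lemma weighted_level_set_inequality (D : set T) (E : set S) (F : T -> \bar R)
    (G : S -> \bar R) (w : T -> R) (u : S -> R) (p q C : R) :
  (0 < p)%R -> (p <= q)%R -> (0 <= C)%R ->
  measurable D -> measurable_fun D w -> (forall z, D z -> 0 <= w z)%R ->
  measurable E -> measurable_fun E u -> (forall t, E t -> 0 <= u t)%R ->
  (forall z, 0 <= F z) ->
  (forall l : R, (0 <= l)%R -> measurable (D `&` [set z | l%:E < F z])) ->
  (forall t, 0 <= G t) ->
  (forall l : R, (0 <= l)%R -> measurable (E `&` [set t | l%:E < G t])) ->
  (forall l : R, (0 < l)%R ->
    (\int[mu]_(z in D `&` [set z | l%:E < F z]) (w z)%:E) `^ q^-1 <=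
    C%:E * (\int[nu]_(t in E `&` [set t | l%:E < G t]) (u t)%:E) `^ p^-1) ->
  (\int[mu]_(z in D) (F z `^ q * (w z)%:E)) `^ q^-1 <=
  C%:E * (\int[nu]_(t in E) (G t `^ p * (u t)%:E)) `^ p^-1.
Proof.
move=> p0 pq C0 mD mw w0 mE mu_ u0 F0 mF G0 mG FG.
have q0 : (0 < q)%R by exact: lt_le_trans pq.
pose r := (q / p)%R.
have r1 : (1 <= r)%R by rewrite ler_pdivlMr// mul1r.
have pV0 : (0 <= p^-1)%R by rewrite invr_ge0 ltW.
have rVE : (r^-1 = q^-1 * p)%R by rewrite invf_div mulrC.
have int_patch d0 (U : measurableType d0) (m : {measure set U -> \bar R})
    (A B : set U) (v : U -> R) : A `<=` B ->
    \int[m]_(z in A) ((v \_ B) z)%:E = \int[m]_(z in A) (v z)%:E.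
  by move=> AB; apply: eq_integral => z; rewrite inE => /AB Bz; rewrite patchE mem_set.
have patch_int d0 (U : measurableType d0) (m : {measure set U -> \bar R})
    (B : set U) (f : U -> \bar R) (v : U -> R) (s : R) :
    \int[m]_(z in B) (f z `^ s * (v z)%:E) =
    \int[m]_z ((f \_ B) z `^ s * ((v \_ B) z)%:E).
  rewrite integral_mkcond; apply: eq_integral => z _; rewrite !patchE.
  by case: ifP; rewrite ?mule0.
have := @level_set_inequality _ _ _ _ _ mu nu
  (fun z => (F \_ D) z `^ p) (fun t => (G \_ E) t `^ p) (w \_ D) (u \_ E)
  r (C `^ p)%R r1 (powR_ge0 _ _).
have -> : \int[mu]_z (((F \_ D) z `^ p) `^ r * ((w \_ D) z)%:E) =
    \int[mu]_(z in D) (F z `^ q * (w z)%:E).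
  rewrite patch_int; apply: eq_integral => z _.
  by rewrite -poweRrM /r mulrCA divff ?mulr1// gt_eqF.
rewrite -patch_int.
set X := \int[mu]_(z in D) _; set Y := \int[nu]_(t in E) _.
have X0 : 0 <= X by apply: integral_ge0 => z Dz; rewrite mule_ge0 ?poweR_ge0 ?lee_fin ?w0.
have Y0 : 0 <= Y by apply: integral_ge0 => z Dz; rewrite mule_ge0 ?poweR_ge0 ?lee_fin ?u0.
move=> key; suff : X `^ r^-1 <= (C `^ p)%:E * Y.
  move=> XY; have -> : X `^ q^-1 = (X `^ r^-1) `^ p^-1.
    by rewrite -poweRrM rVE -mulrA divff ?mulr1// gt_eqF.
  have -> : C%:E * Y `^ p^-1 = ((C `^ p)%:E * Y) `^ p^-1.
    by rewrite poweRM ?lee_fin ?powR_ge0// -poweR_EFin poweRK ?lee_fin.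
  by apply: lee_poweR => //; exact: poweR_ge0.
apply: key.
- exact/(measurable_restrictT _ mD).
- exact: patch_ge0.
- exact/(measurable_restrictT _ mE).
- exact: patch_ge0.
- apply: (measurableT_comp (measurable_poweR _)).
  exact: measurable_restrict_superlevel.
- by move=> z; exact: poweR_ge0.
- apply: (measurableT_comp (measurable_poweR _)).
  exact: measurable_restrict_superlevel.
- by move=> z; exact: poweR_ge0.
- move=> l l0; rewrite !superlevel_patch//.
  rewrite !int_patch; [|exact: subIsetl|exact: subIsetl].
  have lp0 : (0 < l `^ p^-1)%R by exact: powR_gt0.
  have I0 : 0 <= \int[nu]_(t in E `&` [set t | (l `^ p^-1)%:E < G t]) (u t)%:E.
    by apply: integral_ge0 => t [Et _]; rewrite lee_fin u0.
  rewrite rVE poweRrM -[X in _ * X](poweRVK p0 I0).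
  rewrite -(poweR_EFin C p) -poweRM ?lee_fin ?poweR_ge0//; apply: lee_poweR; [exact: ltW|exact: poweR_ge0|].
  exact: FG.
Qed.

End weighted_level_sets.

(** * Decreasing sets *)

Section decreasing_sets.
Local Open Scope ereal_scope.
Context {R : realType}.
Notation leb := (@lebesgue_measure R).
Notation leb2 := (leb \x leb).
Implicit Types (X : set R) (A D : set (R * R)).

Lemma decreasing_setP D : decreasing_set D <->
  [/\ D `<=` quadrant,
      forall s s' t, (0 < s)%R -> (s <= s')%R -> D (s', t) -> D (s, t)
    & forall s t t', (0 < t)%R -> (t <= t')%R -> D (s, t') -> D (s, t)].
Proof.
have indic_le (z z' : R * R) : (\1_D z' <= \1_D z :> R)%R <-> (D z' -> D z).
  rewrite !indicE; split.
    by move=> + /mem_set Dz'; rewrite Dz'; case: (boolP (z \in D)) => [/set_mem//|_]; rewrite ler10.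
  move=> DD; case: (boolP (z' \in D)) => [/set_mem/DD/mem_set -> //|_].
  by rewrite ler0n.
split=> [[DQ Ds Dt]|[DQ Ds Dt]]; split => //.
- move=> s s' t s0 ss' Dz; have [_ t0] := DQ _ Dz.
  by apply: (iffLR (indic_le _ _)) Dz; exact: Ds.
- move=> s t t' t0 tt' Dz; have [s0 _] := DQ _ Dz.
  by apply: (iffLR (indic_le _ _)) Dz; exact: Dt.
- by move=> s s' t s0 ss' t0; apply/indic_le; exact: Ds ss'.
- by move=> s t t' s0 t0 tt'; apply/indic_le; exact: Dt tt'.
Qed.

Lemma rearr_set_decreasing A : decreasing_set (rearr_set A).
Proof.
apply/decreasing_setP; split.
- by move=> z [z1 z2 _]; split.
- move=> s s' t s0 ss' [/= s'0 t0 h]; split => //=.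
  by apply: le_lt_trans h; rewrite lee_fin.
- move=> s t t' t0 tt' [/= s0 t'0 h]; split => //=.
  apply: lt_le_trans h _; apply: le_mu1 => x /=.
  by apply: le_lt_trans; rewrite lee_fin.
Qed.

(** A subset of the open half-line which, with each of its points, contains all
    the smaller positive numbers. *)
Definition down_closed X :=
  X `<=` halfline /\ forall s s', (0 < s)%R -> (s <= s')%R -> X s' -> X s.

Lemma down_closed_le X s : down_closed X -> X s -> s%:E <= mu1 X.
Proof.
move=> [X0 XX] Xs; have s0 : (0 < s)%R by exact: X0.
rewrite -[leLHS](@lebesgue_hypograph _ s%:E) ?lee_fin ?(ltW s0)//.
apply: le_mu1 => x /= [x0]; rewrite lte_fin => xs.
exact: XX (ltW xs) Xs.
Qed.

Lemma down_closed_lt X s : down_closed X -> (0 < s)%R -> s%:E < mu1 X -> X s.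
Proof.
move=> [X0 XX] s0; apply: contraPP => nXs; apply/negP; rewrite -leNgt.
rewrite -[leRHS](@lebesgue_hypograph _ s%:E) ?lee_fin ?(ltW s0)//.
apply: le_mu1 => x Xx /=; split; first exact: X0.
by rewrite lte_fin ltNge; apply/negP => sx; apply: nXs; exact: XX sx Xx.
Qed.

Lemma mu1_point (b : \bar R) : mu1 [set t : R | t%:E = b] = 0.
Proof.
case: b => [b| |].
- rewrite (_ : [set _ | _] = [set b]); first exact: lebesgue_measure_set1.
  by apply/seteqP; split => t /=; [case|move=> ->].
- by rewrite (_ : [set _ | _] = set0) ?measure0//; apply/seteqP; split.
- by rewrite (_ : [set _ | _] = set0) ?measure0//; apply/seteqP; split.
Qed.

Lemma null_graph_x (b : R -> \bar R) : measurable_fun setT b ->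
  mu2 [set z : R * R | z.2%:E = b z.1] = 0.
Proof.
move=> mb; have mg : measurable [set z : R * R | z.2%:E = b z.1].
  have := @measurable_eqe _ _ _ [set: R * R] measurableT (EFin \o snd) (b \o fst).
  rewrite setTI; apply; first exact: measurable_esnd.
  by apply: measurableT_comp => //; exact: measurable_fst.
rewrite mu2E// leb2_xsection; apply: integral0_eq => x _.
rewrite -[RHS](mu1_point (b x)) mu1E; congr (leb _).
by apply/seteqP; split => y /=; rewrite /xsection/= inE.
Qed.

Lemma null_graph_y (b : R -> \bar R) : measurable_fun setT b ->
  mu2 [set z : R * R | z.1%:E = b z.2] = 0.
Proof.
move=> mb; have mg : measurable [set z : R * R | z.1%:E = b z.2].
  have := @measurable_eqe _ _ _ [set: R * R] measurableT (EFin \o fst) (b \o snd).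
  rewrite setTI; apply; first exact: measurable_efst.
  by apply: measurableT_comp => //; exact: measurable_snd.
rewrite mu2E// leb2_ysection//; apply: integral0_eq => y _.
rewrite -[RHS](mu1_point (b y)) mu1E; congr (leb _).
by apply/seteqP; split => x /=; rewrite /ysection/= inE.
Qed.

Lemma xsection_down_closed D x : decreasing_set D -> down_closed (xsection D x).
Proof.
move=> /decreasing_setP[DQ _ Dt]; split => [t /xsectionP /DQ[]//|t t' t0 tt'].
by move=> /xsectionP Dz; apply/xsectionP; exact: Dt Dz.
Qed.

Lemma ysection_down_closed D y : decreasing_set D -> down_closed (ysection D y).
Proof.
move=> /decreasing_setP[DQ Ds _]; split => [t /ysectionP /DQ[]//|t t' t0 tt'].
by move=> /ysectionP Dz; apply/ysectionP; exact: Ds Dz.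
Qed.

(** The lengths of the vertical sections of a decreasing set are nonincreasing on
    the half-line, and vanish off it. *)
Lemma measurable_profile D : decreasing_set D ->
  measurable_fun setT (fun x => mu1 (xsection D x)).
Proof.
move=> decD; have /decreasing_setP[DQ Ds Dt] := decD.
apply: measurable_fun_superlevel => l; apply: is_interval_measurable.
have [l0|l0] := leP 0%R l; last first.
  move=> x y _ _ z _ /=; apply: lt_le_trans (mu1_ge0 _).
  by rewrite lte_fin.
move=> x y lx ly z /andP[xz zy] /=.
have x0 : (0 < x)%R.
  rewrite ltNge; apply/negP => x0; move: lx => /=.
  rewrite (_ : xsection D x = set0); last first.
    by apply/seteqP; split => // t /xsectionP/DQ[/=]; rewrite ltNge x0.
  by rewrite measure0 lte_fin ltNge l0.
apply: lt_le_trans ly _; apply: le_mu1 => t /xsectionP Dyt; apply/xsectionP.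
exact: Ds (lt_le_trans x0 xz) zy Dyt.
Qed.

(** The open region under the graph of the lengths of the vertical sections of
    [D]. *)
Definition subgraph D : set (R * R) :=
  [set z | [/\ (0 < z.1)%R, (0 < z.2)%R & z.2%:E < mu1 (xsection D z.1)]].

Lemma subgraph_measurable D : decreasing_set D -> measurable (subgraph D).
Proof.
move=> decD; have mb := measurable_profile decD.
have mbelow := measurable_below_x mb.
rewrite (_ : subgraph D =
  quadrant `&` [set z | z.2%:E < mu1 (xsection D z.1)]).
  by apply: measurableI => //; exact: measurable_quadrant.
by apply/seteqP; split => z; [case|case=> -[]].
Qed.

Lemma subgraph_sub D : decreasing_set D -> subgraph D `<=` D.
Proof.
move=> decD [s t] [/= s0 t0 st]; apply/xsectionP.
exact: down_closed_lt (xsection_down_closed _ decD) t0 st.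
Qed.

Lemma subgraph_decreasing D : decreasing_set D -> decreasing_set (subgraph D).
Proof.
move=> decD; have /decreasing_setP[DQ Ds Dt] := decD.
apply/decreasing_setP; split.
- by move=> z [z1 z2 _]; split.
- move=> s s' t s0 ss' [/= s'0 t0 h]; split => //=.
  apply: lt_le_trans h _; apply: le_mu1 => y /xsectionP Dy; apply/xsectionP.
  exact: Ds ss' Dy.
- move=> s t t' t0 tt' [/= s0 t'0 h]; split => //=.
  by apply: le_lt_trans h; rewrite lee_fin.
Qed.

(** The points of [D] that are not in [subgraph D] lie on the graph of the lengths
    of the vertical sections, which is a null set. *)
Lemma same2_subgraph D : decreasing_set D -> same2 D (subgraph D).
Proof.
move=> decD; have /decreasing_setP[DQ _ _] := decD.
split; last first.
  by rewrite (_ : _ `\` _ = set0) ?measure0// setD_eq0; exact: subgraph_sub.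
apply: sub_mu2_0 (null_graph_x (measurable_profile decD)).
move=> [s t] [Dst nU] /=; have [s0 t0] := DQ _ Dst.
apply/eqP; rewrite eq_le (down_closed_le (xsection_down_closed s decD)); last exact/xsectionP.
by rewrite leNgt; apply/negP => ts; apply: nU; split.
Qed.

Lemma decreasing_measurable D : decreasing_set D ->
  measurable (D : set (plane R)).
Proof.
move=> decD; apply: (same2_measurable (same2_subgraph decD)).
by apply: borel_plane; exact: subgraph_measurable.
Qed.

Lemma rearr_set_subgraph D : decreasing_set D -> rearr_set (subgraph D) =
  [set z | [/\ (0 < z.1)%R, (0 < z.2)%R &
    z.1%:E < mu1 (ysection (subgraph D) z.2)]].
Proof.
move=> decD; have /decreasing_setP[DQ Ds Dt] := decD.
have profE x : mu1 (xsection (subgraph D) x) = mu1 (xsection D x).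
  have [x0|x0] := ltP 0%R x.
    rewrite mu1E -[RHS]lebesgue_hypograph ?mu1_ge0//; congr (leb _).
    by apply/seteqP; split => y /=; rewrite /xsection/= inE; case.
  rewrite (_ : xsection (subgraph D) x = set0); last first.
    by apply/seteqP; split => // t /xsectionP[/=]; rewrite ltNge x0.
  rewrite (_ : xsection D x = set0)//.
  by apply/seteqP; split => // t /xsectionP/DQ[/=]; rewrite ltNge x0.
have distE t : (0 < t)%R ->
    [set x | t%:E < mu1 (xsection (subgraph D) x)] = ysection (subgraph D) t.
  move=> t0; apply/seteqP; split => x /=; last first.
    by move=> /ysectionP[]; rewrite profE.
  rewrite profE => tx; apply/ysectionP; split => //=.
  rewrite ltNge; apply/negP => x0; move: tx.
  rewrite (_ : xsection D x = set0); last first.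
    by apply/seteqP; split => // y /xsectionP/DQ[/=]; rewrite ltNge x0.
  by rewrite measure0 lte_fin ltNge ltW.
by apply/seteqP; split => z [z1 z2 h]; split => //; [rewrite -distE|rewrite distE].
Qed.

(** Same argument for the horizontal sections of [subgraph D], whose rearranged
    set is the region to the left of the graph of their lengths. *)
Lemma same2_rearr_subgraph D : decreasing_set D -> same2 (subgraph D) (rearr_set (subgraph D)).
Proof.
move=> decD; rewrite rearr_set_subgraph//.
have decU := subgraph_decreasing decD; have mU := subgraph_measurable decD.
split; last first.
  rewrite (_ : _ `\` _ = set0) ?measure0// setD_eq0 => -[s t] [/= s0 t0 st].
  apply/ysectionP; exact: down_closed_lt (ysection_down_closed _ decU) s0 st.
have := null_graph_y (measurable_fun_ysection leb mU); apply: sub_mu2_0.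
move=> [s t] [Ust nU] /=; have [/= s0 t0 _] := Ust.
apply/eqP; rewrite eq_le (down_closed_le (ysection_down_closed t decU)); last exact/ysectionP.
by rewrite leNgt; apply/negP => ts; apply: nU; split.
Qed.

Lemma same2_trans A B D : same2 A B -> same2 B D -> same2 A D.
Proof.
have suf (X Y Z : set (R * R)) : mu2 (X `\` Y) = 0 -> mu2 (Y `\` Z) = 0 ->
    mu2 (X `\` Z) = 0.
  move=> XY YZ; apply/eqP; rewrite eq_le mu2_ge0 andbT.
  apply: (@le_trans _ _ (mu2 (X `\` Y) + mu2 (Y `\` Z))); last by rewrite XY YZ adde0.
  apply: le_trans (le_mu2U _ _); apply: le_mu2 => z [Xz nZz].
  by have [Yz|nYz] := pselect (Y z); [right|left].
by move=> [AB BA] [BD DB]; split; [exact: suf AB BD|exact: suf DB BA].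
Qed.

(** A decreasing set is its own rearrangement, up to a null set. *)
Lemma same2_rearr_set D : decreasing_set D -> same2 D (rearr_set D).
Proof.
move=> decD; rewrite (rearr_set_same2 (same2_subgraph decD)).
exact: same2_trans (same2_subgraph decD) (same2_rearr_subgraph decD).
Qed.

End decreasing_sets.

(** * The embedding and its best constant *)

(** Chebyshev's inequality, in qualitative form. *)
Lemma superlevel_integral_lty d (T : measurableType d) (R : realType)
    (mu : {measure set T -> \bar R}) (D : set T) (G : T -> \bar R) (u : T -> R)
    (p l : R) :
  ((0 < p)%R -> (0 < l)%R -> measurable D -> measurable (D `&` [set t | l%:E < G t]%E) ->
  (forall t, 0 <= G t) -> (forall t, D t -> (0 <= u t)%R) ->
  measurable_fun D u -> measurable_fun D (fun t => G t `^ p * (u t)%:E)%E ->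
  \int[mu]_(t in D) (G t `^ p * (u t)%:E) < +oo ->
  \int[mu]_(t in D `&` [set t | l%:E < G t]) (u t)%:E < +oo)%E.
Proof.
move=> p0 l0 mD mL G0 u0 mu_ mGu Goo.
have lp0 : 0 < l `^ p by exact: powR_gt0.
have : ((l `^ p)%:E * \int[mu]_(t in D `&` [set t | l%:E < G t]) (u t)%:E <=
    \int[mu]_(t in D) (G t `^ p * (u t)%:E))%E.
  rewrite -ge0_integralZl_EFin ?(ltW lp0)//; last 2 first.
  - by move=> t [Dt _]; rewrite lee_fin u0.
  - by apply/measurable_EFinP; apply: measurable_funS mu_ => // t [].
  apply: le_trans (ge0_subset_integral mu mL mD mGu _ _); last first.
  - exact: subIsetl.
  - by move=> t Dt; rewrite mule_ge0 ?poweR_ge0 ?lee_fin ?u0.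
  apply: ge0_le_integral => //.
  - by move=> t [Dt _]; rewrite mule_ge0 ?lee_fin ?u0// ltW.
  - apply: emeasurable_funM => //.
    by apply/measurable_EFinP; apply: measurable_funS mu_ => // t [].
  - by apply: measurable_funS mGu => // t [].
  - move=> t [Dt /= lG]; apply: lee_wpmul2r; first by rewrite lee_fin u0.
    by rewrite -poweR_EFin lee_poweR ?lee_fin// ltW.
move=> /le_lt_trans/(_ Goo); rewrite !ltey; apply: contra_neq => ->.
by rewrite gt0_muley// lte_fin.
Qed.

Lemma ge0_integral_ae_eq_set d (T : measurableType d) (R : realType)
    (mu : {measure set T -> \bar R}) (D A B : set T) (f : T -> \bar R) :
  measurable A -> measurable B -> A `<=` D -> B `<=` D ->
  (forall x, D x -> 0 <= f x)%E -> measurable_fun D f -> measurable D ->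
  mu (A `\` B) = 0%E -> mu (B `\` A) = 0%E ->
  (\int[mu]_(x in A) f x = \int[mu]_(x in B) f x)%E.
Proof.
move=> mA mB AD BD f0 mf mD AB BA.
have mfS X : X `<=` D -> measurable_fun X f by move=> XD; exact: measurable_funS mf.
rewrite (@ge0_negligible_integral _ _ _ mu A (A `\` B)) ?setDD//; first last.
- by move=> x /AD; exact: f0.
- exact: mfS.
- exact: measurableD.
rewrite [RHS](@ge0_negligible_integral _ _ _ mu B (B `\` A)) ?setDD//; first last.
- by move=> x /BD; exact: f0.
- exact: mfS.
- exact: measurableD.
by rewrite setIC.
Qed.

Section embedding.
Local Open Scope ereal_scope.
Context {R : realType}.
Variables (p q : R) (u : R -> R) (w : R * R -> R).
Hypotheses (hp : (0 < p)%R) (hpq : (p <= q)%R) (hu : weight1 u) (hw : weight2 w).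
Notation leb := (@lebesgue_measure R).
Implicit Types (f : R * R -> R) (D : set (R * R)).

Let q0 : (0 < q)%R. Proof. exact: lt_le_trans hpq. Qed.
Let pV0 : (0 <= p^-1)%R. Proof. by rewrite invr_ge0 ltW. Qed.
Let qV0 : (0 <= q^-1)%R. Proof. by rewrite invr_ge0 ltW. Qed.

(* the rearrangements, on the measure spaces over which they are integrated *)
Let F f (z : plane R) := rearrangement_yx f z.1 z.2.
Let G f (t : line R) := rearrangement mu2 (EFin \o f) t.

(* the integrals in the quotient attached to a decreasing set *)
Let U D := \int[mu1]_(t in [set t : R | (0 < t)%R /\ t%:E < mu2 D]) (u t)%:E.
Let W D := \int[mu2]_(z in D) (w z)%:E.

Let mQ : measurable (quadrant : set (plane R)).
Proof. by apply: borel_plane; exact: measurable_quadrant. Qed.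

Let mH : measurable (halfline : set (line R)).
Proof.
apply: borel_line; rewrite (_ : halfline = [set` `]0%R, +oo[ ])//.
by apply/seteqP; split => t /=; rewrite in_itv/= andbT.
Qed.

Let F0 f z : 0 <= F f z.
Proof. apply: rearrangement_ge0; exact: mu1_setT. Qed.

Let G0 f t : 0 <= G f t.
Proof. apply: rearrangement_ge0; exact: mu2_setT. Qed.

Let levelF f (l : R) : measurable_fun (setT : set (plane R)) f -> (0 <= l)%R ->
  quadrant `&` [set z | l%:E < F f z] = rearr_set (superlevel f l).
Proof. exact: superlevel_rearrangement_yx. Qed.

Let levelG f (l : R) : measurable_fun (setT : set (plane R)) f -> (0 <= l)%R ->
  halfline `&` [set t | l%:E < G f t] =
  [set t : R | (0 < t)%R /\ t%:E < mu2 (superlevel f l)].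
Proof.
move=> mf l0; apply/seteqP; split => t [t0 lt]; split => //.
- by apply: (iffLR (lt_rearrangement2 _ _ _)) lt.
- by apply: (iffRL (lt_rearrangement2 _ _ _)) lt.
Qed.

Let measurable_below (b : \bar R) :
  measurable ([set t : R | (0 < t)%R /\ t%:E < b] : set (line R)).
Proof.
apply: borel_line; apply: is_interval_measurable => x y [x0 xb] [y0 yb] z.
move=> /andP[xz zy]; split; first exact: lt_le_trans xz.
by apply: le_lt_trans yb; rewrite lee_fin.
Qed.

Let mlevelF f (l : R) : measurable_fun (setT : set (plane R)) f -> (0 <= l)%R ->
  measurable (quadrant `&` [set z | l%:E < F f z] : set (plane R)).
Proof.
by move=> mf l0; rewrite levelF//; exact/rearr_set_measurable/superlevel_measurable.
Qed.

Let mlevelG f (l : R) : measurable_fun (setT : set (plane R)) f -> (0 <= l)%R ->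
  measurable (halfline `&` [set t | l%:E < G f t] : set (line R)).
Proof. by move=> mf l0; rewrite levelG//; exact: measurable_below. Qed.

Let mFw f : measurable_fun (setT : set (plane R)) f ->
  measurable_fun (quadrant : set (plane R)) (fun z => F f z `^ q * (w z)%:E).
Proof.
move=> mf; have [_ mw _] := hw; apply: emeasurable_funM.
  apply: (measurableT_comp (measurable_poweR _)).
  apply/(measurable_restrictT _ mQ)/measurable_restrict_superlevel => // l l0.
  exact: mlevelF.
exact/measurable_EFinP.
Qed.

Let mGu f : measurable_fun (setT : set (plane R)) f ->
  measurable_fun (halfline : set (line R)) (fun t => G f t `^ p * (u t)%:E).
Proof.
move=> mf; have [_ mu_ _] := hu; apply: emeasurable_funM.
  apply: (measurableT_comp (measurable_poweR _)).
  apply/(measurable_restrictT _ mH)/measurable_restrict_superlevel => // l l0.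
  exact: mlevelG.
exact/measurable_EFinP.
Qed.

Let U_ge0 D : 0 <= U D.
Proof. by have [u0 _ _] := hu; apply: integral_ge0 => t [t0 _]; rewrite lee_fin u0. Qed.

Let W_ge0 D : decreasing_set D -> 0 <= W D.
Proof.
have [w0 _ _] := hw => /decreasing_setP[DQ _ _].
by apply: integral_ge0 => z /DQ Qz; rewrite lee_fin w0.
Qed.

Let ratioE D : decreasing_ratio p q u w D = W D `^ q^-1 / U D `^ p^-1.
Proof. by []. Qed.

(** The two directions of the equivalence between [a / b <= c] and [a <= c * b].
    With [0 / 0 = 0] and [a / 0 = +oo] for [a > 0] it also holds for [b = 0]; for
    [b = +oo] the quotient is [0] and gives no information. *)
Lemma divide_le (a b : \bar R) (c : R) : 0 <= a -> 0 <= b -> b < +oo ->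
  (0 <= c)%R -> a / b <= c%:E -> a <= c%:E * b.
Proof.
move=> a0 b0 boo c0; case: b b0 boo => [b| |]//; rewrite lee_fin => b0 _.
have [->|bn0] := eqVneq b 0%R.
  rewrite inve0 mule0; have [->//|an0] := eqVneq a 0.
  have a_gt0 : 0 < a by rewrite lt_neqAle eq_sym an0.
  by rewrite gt0_muley// leye_eq.
have b_gt0 : (0 < b)%R by rewrite lt_neqAle eq_sym bn0.
by rewrite inver (negbTE bn0) lee_pdivrMr.
Qed.

Lemma le_divide (a b : \bar R) (c : R) : 0 <= a -> 0 <= b ->
  (0 <= c)%R -> (b < +oo -> a <= c%:E * b) -> a / b <= c%:E.
Proof.
move=> a0 b0 c0; case: b b0 => [b| |]//; last by rewrite invey mule0 lee_fin.
rewrite lee_fin => b0 /(_ (ltry _)).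
have [->|bn0] := eqVneq b 0%R.
  by rewrite mule0 => a0'; rewrite (_ : a = 0) ?mul0e ?lee_fin//; apply/le_anti/andP.
have b_gt0 : (0 < b)%R by rewrite lt_neqAle eq_sym bn0.
by rewrite inver (negbTE bn0) lee_pdivrMr.
Qed.

Let U_superlevel f (l : R) : Lambda p u f -> (0 < l)%R ->
  U (superlevel f l) < +oo.
Proof.
move=> [mf foo] l0; have [u0 mu_ _] := hu.
rewrite /U -levelG ?(ltW l0)//.
apply: (@superlevel_integral_lty _ (line R) _ mu1 halfline (G f) u p l hp l0 mH
  (mlevelG mf (ltW l0)) (G0 f) u0 mu_ (mGu mf)).
by apply: lty_poweRy foo; rewrite invr_neq0// gt_eqF.
Qed.

(** The supremum is tested on the rearranged superlevel sets of [f]; their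
    quotients give information because [U] is finite on them, by Chebyshev's
    inequality. *)
Lemma embedding_of_sup (C : R) : decreasing_sup p q u w = C%:E ->
  embedding_constant p q u w C.
Proof.
move=> supC; have [u0 mu_ _] := hu; have [w0 mw _] := hw.
have ratioC D : decreasing_set D -> decreasing_ratio p q u w D <= C%:E.
  by move=> decD; rewrite -supC; apply: ereal_sup_ubound; exists D.
have C0 : (0 <= C)%R.
  rewrite -lee_fin; apply: le_trans (ratioC _ (rearr_set_decreasing set0)).
  by rewrite ratioE mule_ge0 ?inve_ge0 ?poweR_ge0.
split=> // f Lf; have [mf foo] := Lf.
apply: (weighted_level_set_inequality (mu := mu2) (nu := mu1) (F := F f) (G := G f)) => //.
- by move=> l l0; exact: mlevelF.
- by move=> l l0; exact: mlevelG.
move=> l l0; rewrite levelF ?(ltW l0)// levelG ?(ltW l0)//.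
have decD := rearr_set_decreasing (superlevel f l).
have muE : mu2 (rearr_set (superlevel f l)) = mu2 (superlevel f l).
  exact/mu2_rearr_set/superlevel_measurable.
have UE : U (rearr_set (superlevel f l)) = U (superlevel f l) by rewrite /U muE.
change (W (rearr_set (superlevel f l)) `^ q^-1 <=
  C%:E * U (superlevel f l) `^ p^-1).
rewrite -UE; apply: divide_le; [exact: poweR_ge0|exact: poweR_ge0| |exact: C0|].
  by apply: poweR_lty; rewrite UE; exact: U_superlevel.
by rewrite -ratioE; exact: ratioC.
Qed.

Let superlevel_indic D (l : R) : (0 <= l < 1)%R -> superlevel \1_D l = D.
Proof.
move=> /andP[l0 l1]; apply/seteqP; split => z; rewrite /superlevel/= indicE.
  by case: (boolP (z \in D)) => [/set_mem//|_]; rewrite /= normr0 lte_fin ltNge l0.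
by move=> Dz; rewrite mem_set//= normr1 lte_fin.
Qed.

Let integral_same2 (A B : set (R * R)) :
  measurable (A : set (plane R)) -> measurable (B : set (plane R)) ->
  A `<=` quadrant -> B `<=` quadrant -> same2 A B ->
  \int[mu2]_(z in A) (w z)%:E = \int[mu2]_(z in B) (w z)%:E.
Proof.
have [w0 mw _] := hw => mA mB AQ BQ [AB BA].
have w0' (z : plane R) : quadrant z -> 0 <= (EFin \o w) z.
  by move=> Qz; rewrite lee_fin w0.
have mw' : measurable_fun (quadrant : set (plane R)) (EFin \o w).
  exact/measurable_EFinP.
exact: (@ge0_integral_ae_eq_set _ (plane R) _ mu2 quadrant A B (EFin \o w)
  mA mB AQ BQ w0' mw' mQ AB BA).
Qed.

(** The embedding is tested on the indicator function of [D]. *)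
Lemma ratio_le_embedding (c : R) D : embedding_constant p q u w c ->
  decreasing_set D -> decreasing_ratio p q u w D <= c%:E.
Proof.
move=> [c0 emb] decD; have [u0 mu_ _] := hu; have [w0 mw _] := hw.
have mD := decreasing_measurable decD; have /decreasing_setP[DQ _ _] := decD.
have mf : measurable_fun (setT : set (plane R)) (\1_D : R * R -> R).
  exact: (@measurable_indic _ (plane R)).
rewrite ratioE; apply: le_divide => //; [exact: poweR_ge0|exact: poweR_ge0|].
move=> Uoo.
have mI : measurable ([set t | t%:E < mu2 D] : set (line R)).
  apply: borel_line; apply: is_interval_measurable => x y _ yb z /andP[_ zy] /=.
  by apply: le_lt_trans yb; rewrite lee_fin.
have normE : Lambda_norm p u \1_D <= U D `^ p^-1.
  apply: lee_poweR => //.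
    by apply: integral_ge0 => t t0; rewrite mule_ge0 ?poweR_ge0 ?lee_fin ?u0.
  rewrite /U (_ : [set t : R | _] = halfline `&` [set t | t%:E < mu2 D])//.
  rewrite integral_mkcondr; apply: (ge0_le_integral mu1 mH).
  - by move=> t t0; rewrite mule_ge0 ?poweR_ge0 ?lee_fin ?u0.
  - exact: mGu.
  - apply/(measurable_restrict _ mI mH)/measurable_EFinP.
    by apply: measurable_funS mu_ => // t [].
  - move=> t t0.
    have G1 : G \1_D t <= 1.
      apply: ereal_inf_lbound; exists 1%R => //=.
      rewrite (_ : [set _ | _] = set0) ?measure0 ?lee_fin ?(ltW t0)//.
      apply/seteqP; split => // z; rewrite /= indicE.
      by case: (z \in D); rewrite ?normr1 ?normr0 lte_fin ?ltxx ?ltr10.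
    rewrite patchE; case: ifPn => [_|/negP tD].
      rewrite -[leRHS]mul1e lee_wpmul2r ?lee_fin ?u0//.
      by rewrite -[leRHS](poweR1r p); apply: lee_poweR; [exact: ltW|exact: G0|exact: G1].
    suff G00 : G \1_D t = 0.
      change (G \1_D t `^ p * (u t)%:E <= 0).
      by rewrite G00 poweR0r ?gt_eqF// mul0e.
    apply/eqP; rewrite eq_le G0 andbT leNgt; apply/negP.
    move=> /(iffLR (lt_rearrangement2 _ _ mf)); rewrite superlevel_indic ?lexx ?ltr01//.
    by move=> tD'; apply: tD; rewrite inE.
have Lf : Lambda p u \1_D by split => //; exact: le_lt_trans normE Uoo.
apply: (@le_trans _ _ (Lambda2_norm q w \1_D)); last first.
  by apply: le_trans (emb _ Lf) _; apply: lee_wpmul2l; rewrite ?lee_fin.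
apply: lee_poweR => //; first exact: W_ge0.
have /decreasing_setP[rQ _ _] := rearr_set_decreasing D.
have mr := rearr_set_measurable mD.
rewrite /W (integral_same2 mD mr DQ rQ (same2_rearr_set decD)).
apply: le_trans (ge0_subset_integral mu2 mr mQ (mFw mf) _ rQ); last first.
  by move=> z Qz; rewrite mule_ge0 ?poweR_ge0 ?lee_fin ?w0.
apply: (ge0_le_integral mu2 mr).
- by move=> z rz; rewrite lee_fin w0//; exact: rQ.
- by apply/measurable_EFinP; exact: measurable_funS mw.
- exact: measurable_funS (mFw mf).
move=> z rz; rewrite -[leLHS]mul1e lee_wpmul2r ?lee_fin ?w0//; first exact: rQ.
rewrite -[leLHS](poweR1r q); apply: lee_poweR; [exact: ltW|exact: lee01|].
apply: lee_real_lt => l; rewrite lte_fin => l1.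
have [l0|l0] := leP 0%R l; last by apply: le_trans (F0 _ _); rewrite lee_fin ltW.
have := levelF mf l0; rewrite superlevel_indic ?l0// => rE.
by move: rz; rewrite -rE => -[_ /ltW].
Qed.

End embedding.

Local Open Scope ring_scope.

Theorem theorem3p1 (R : realType) (p q : R) (u : R -> R) (w : R * R -> R)
    (hp : 0 < p) (hpq : p <= q) (hu : weight1 u) (hw : weight2 w) :
  (embedded p q u w <-> (decreasing_sup p q u w < +oo)%E) /\
  (embedded p q u w ->
     exists2 C : R, decreasing_sup p q u w = C%:E &
       best_embedding_constant p q u w C).
Proof.
have sup_le c : embedding_constant p q u w c -> (decreasing_sup p q u w <= c%:E)%E.
  by move=> emb; apply: ge_ereal_sup => _ [D decD <-]; exact: ratio_le_embedding.
have supE : (decreasing_sup p q u w < +oo)%E ->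
    decreasing_sup p q u w = (fine (decreasing_sup p q u w))%:E.
  move=> supoo; rewrite fineK// ge0_fin_numE//.
  apply: le_trans (_ : decreasing_ratio p q u w (rearr_set set0) <= _)%E; last first.
    by apply: ereal_sup_ubound; exists (rearr_set set0) => //; exact: rearr_set_decreasing.
  by rewrite /decreasing_ratio mule_ge0 ?inve_ge0 ?poweR_ge0.
have suplty : embedded p q u w -> (decreasing_sup p q u w < +oo)%E.
  by move=> [_ [c /sup_le /le_lt_trans -> //]]; rewrite ltry.
split; last first.
  move=> /suplty/supE supC; exists (fine (decreasing_sup p q u w)) => //.
  split; first exact: embedding_of_sup.
  by move=> c /sup_le; rewrite supC lee_fin.
split=> // /supE /(embedding_of_sup hp hpq hu hw) emb.
split; last by exists (fine (decreasing_sup p q u w)).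
move=> f Lf; have [mf foo] := Lf; split => //.
apply: le_lt_trans (emb.2 _ Lf) _.
by rewrite lte_mul_pinfty// ?lee_fin; case: emb.
Qed.
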